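(* For all fixed integers $r\ge 3$ and $k\ge 2$, we have $$\lim_{n\to\infty}\frac{f_r(n,k)}{\binom{n}{\lceil\frac{(r-2)k}{r-1}\rceil}}=\frac{1}{\binom{k}{\lceil\frac{(r-2)k}{r-1}\rceil}-m\left(k,\lfloor\frac{k}{r-1}\rfloor,\lambda\right)},$$ where $\lambda\in\{1,\ldots,r-1\}$ is the unique integer that satisfies $k+\lambda\equiv 0\pmod{r-1}$.
   Context: Write $[n]=\{1,\ldots,n\}$ and let $\binom{X}{k}$ denote the set of all $k$-element subsets of $X$. For $r\ge 3$, a family of $r$ distinct sets $A_0,A_1,\ldots,A_{r-1}\subseteq[n]$ is an $r$-focal hypergraph with focus $A_0$ if for every $x\in A_0$ we have $|\{i\in[r-1]:x\in A_i\}|\ge r-2$. A hypergraph (family of distinct sets, called edges) $\mathcal{F}\subseteq 2^{[n]}$ is $r$-focal-free if it does not contain any $r$-focal hypergraph. It is $k$-uniform if $\mathcal{F}\subseteq\binom{[n]}{k}$. $f_r(n,k)$ denotes the maximum cardinality of an $n$-vertex $r$-focal-free $k$-uniform hypergraph. $m(n,s,\lambda)$ denotes the maximum number of edges that can be contained in an $s$-uniform hypergraph on $n$ vertices that does not contain $\lambda$ pairwise disjoint edges. *)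

(* Defs.v *)
From mathcomp Require Import all_boot all_order all_algebra.
From mathcomp Require Import all_classical all_reals all_analysis.

Set Implicit Arguments.
Unset Strict Implicit.
Unset Printing Implicit Defensive.

Local Open Scope nat_scope.

Definition uniform (n k : nat) (F : {set {set 'I_n}}) : bool :=
  [forall A in F, #|A| == k].

(* The edges other than the focus, A_1, ..., A_{r-1}, are indexed by
   'I_(r - 1). *)
Definition focal (n r : nat) (A0 : {set 'I_n})
    (A : {ffun 'I_(r - 1) -> {set 'I_n}}) : bool :=
  [&& injectiveb A, [forall i, A i != A0]
    & [forall x in A0, r - 2 <= #|[set i | x \in A i]|]].

Definition focal_free (n r : nat) (F : {set {set 'I_n}}) : bool :=
  ~~ [exists A0 : {set 'I_n}, exists A : {ffun 'I_(r - 1) -> {set 'I_n}},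
       [&& A0 \in F, [forall i, A i \in F] & focal A0 A]].

Definition max_focal_free (r n k : nat) : nat :=
  \max_(F : {set {set 'I_n}} | uniform k F && focal_free r F) #|F|.

(* The l edges form an indexed family. Disjoint nonempty edges are distinct, so
   this matters only for the empty edge, which is disjoint from itself: it alone
   provides l pairwise disjoint edges, whence max_no_matching n 0 l = 0. *)
Definition has_matching (n l : nat) (F : {set {set 'I_n}}) : bool :=
  [exists E : {ffun 'I_l -> {set 'I_n}},
    [forall i, E i \in F] &&
    [forall i, forall j, (i != j) ==> [disjoint E i & E j]]].

Definition max_no_matching (n s l : nat) : nat :=
  \max_(F : {set {set 'I_n}} | uniform s F && ~~ has_matching l F) #|F|.

Definition ceil_div (a b : nat) : nat :=
  `|Num.ceil (a%:R / b%:R : rat)%R|%N.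

(* Main.v *)
Require Import Defs.
From mathcomp Require Import all_boot all_order all_algebra all_fingroup.
From mathcomp Require Import ring lra zify.
Import Order.TTheory GRing.Theory Num.Theory.

(** Upper bound. Call a subset of an edge own if no other edge contains it.
    At most C(n,t-1) edges have an own (t-1)-subset, where t = k - s and
    s = floor(k/(r-1)). In any other edge A the complements (in A) of the
    non-own t-subsets cannot contain l disjoint sets: as
    k = l s + (r-1-l)(s+1), these together with r-1-l disjoint (s+1)-sets
    would partition A and give an r-focal hypergraph with focus A. So A has at
    least C(k,t) - m(k,s,l) own t-subsets, and distinct edges have distinct
    ones.

    Lower bound. Let H be extremal for m(k,s,l). In a copy of [k] inside [n]
    call the complements of the s-sets outside H blue and the other t-subsets
    red. If every blue t-set lies in a single copy and two copies meet in at
    most t points, the copies form an r-focal-free family. Declare each t-set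
    of [n] trash with probability eps and keep the copies whose red sets are
    trash and whose blue sets are not: their blue parts form a nearly regular
    hypergraph on the other t-sets with small codegrees, in which the Rödl
    nibble finds an almost perfect matching that also avoids the few pairs of
    copies sharing more than t points. The nibble is run on expectations only:
    what is shown by induction is a bound on the matching that is linear in
    the number of vertices and in the L1-irregularity of the degrees, so that
    no concentration of the vertex number is needed. *)

Set Implicit Arguments.
Unset Strict Implicit.
Unset Printing Implicit Defensive.
Local Open Scope ring_scope.

(** * Random subsets *)

Section RandomSubset.
Variables (R : realFieldType) (I : finType) (p : R).

Definition bernoulli (S : {set I}) : R := \prod_i (if i \in S then p else 1 - p).

Definition expect (f : {set I} -> R) : R := \sum_(S : {set I}) bernoulli S * f S.

Lemma expect_in_out (A B : {set I}) : [disjoint A & B] ->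
  expect (fun S => ((A \subset S) && [disjoint B & S])%:R)
  = p ^+ #|A| * (1 - p) ^+ #|B|.
Proof.
move=> dAB.
have -> : p ^+ #|A| * (1 - p) ^+ #|B| =
    \prod_i ((i \notin B)%:R * p + (i \notin A)%:R * (1 - p)).
  rewrite -!prodr_const (big_mkcond (mem A)) (big_mkcond (mem B)) -big_split /=.
  apply: eq_bigr => i _; case: ifPn => iA; case: ifPn => iB /=; try ring.
  by rewrite (disjointFr dAB iA) in iB.
rewrite bigA_distr; apply: eq_bigr => S _; rewrite /bernoulli.
have [/andP[/subsetP AS BS]|] := boolP (_ && _).
  rewrite mulr1; apply: eq_bigr => i _; case: ifPn => iS.
    by rewrite (contraTN _ iS) ?mul1r // => /(disjointFr BS) ->.
  by rewrite (contraNN (AS i) iS) mul1r.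
rewrite negb_and mulr0 => /orP[/subsetPn[i iA iS]|].
  by rewrite (bigD1 i) //= (negbTE iS) iA /= !mul0r.
rewrite -setI_eq0 => /set0Pn[i]; rewrite inE => /andP[iB iS].
by rewrite (bigD1 i) //= iS iB /= !mul0r.
Qed.

Lemma expect_disjoint (B : {set I}) :
  expect (fun S => [disjoint B & S]%:R) = (1 - p) ^+ #|B|.
Proof.
have := @expect_in_out set0 B; rewrite disjoints_subset sub0set => /(_ isT).
rewrite cards0 expr0 mul1r => <-; apply: eq_bigr => S _.
by rewrite sub0set.
Qed.

Lemma bernoulli_sum1 : \sum_S bernoulli S = 1.
Proof.
have := expect_disjoint set0; rewrite cards0 expr0 => <-.
by apply: eq_bigr => S _; rewrite disjoints_subset sub0set mulr1.
Qed.

Lemma expectD f g : expect (fun S => f S + g S) = expect f + expect g.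
Proof. by rewrite /expect -big_split; apply: eq_bigr => S _; rewrite mulrDr. Qed.

Lemma expectZ c f : expect (fun S => c * f S) = c * expect f.
Proof. by rewrite /expect mulr_sumr; apply: eq_bigr => S _; rewrite mulrCA. Qed.

Lemma expectB f g : expect (fun S => f S - g S) = expect f - expect g.
Proof.
rewrite expectD -[- expect g]mulN1r -expectZ; congr (_ + _).
by apply: eq_bigr => S _; rewrite mulN1r.
Qed.

Lemma expect_sum (J : finType) (P : pred J) (f : J -> {set I} -> R) :
  expect (fun S => \sum_(j | P j) f j S) = \sum_(j | P j) expect (f j).
Proof.
by rewrite /expect exchange_big; apply: eq_bigr => S _; rewrite mulr_sumr.
Qed.

Hypothesis p01 : 0 <= p <= 1.

Lemma bernoulli_ge0 S : 0 <= bernoulli S.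
Proof. case/andP: p01 => p0 p1; apply: prodr_ge0 => i _.
by case: ifP => _; rewrite ?subr_ge0. Qed.

Lemma expect_attained f : exists S, expect f <= f S.
Proof.
have [/existsP //|/existsPn nS] := boolP [exists S, expect f <= f S].
exfalso; suff : \sum_S bernoulli S * (f S - expect f) < 0.
  under eq_bigr do rewrite mulrBr.
  by rewrite sumrB -mulr_suml bernoulli_sum1 mul1r subrr ltxx.
rewrite lt_neqAle sumr_le0 ?andbT; last first.
  move=> S _; rewrite mulr_ge0_le0 ?bernoulli_ge0 // subr_le0 ltW //.
  by rewrite ltNge; apply: nS.
rewrite -oppr_eq0 -sumrN psumr_eq0; last first.
  move=> S _; rewrite -mulrN opprB mulr_ge0 ?bernoulli_ge0 // subr_ge0 ltW //.
  by rewrite ltNge; apply: nS.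
apply/negP => /allP b0; have := bernoulli_sum1; rewrite big1.
  by move/eqP; rewrite eq_sym oner_eq0.
move=> S _; have := b0 S (mem_index_enum _); rewrite /= oppr_eq0 mulf_eq0 subr_eq0.
by case/orP => /eqP // fS; have := nS S; rewrite fS lexx.
Qed.

End RandomSubset.

(** * The nibble *)

Lemma card_bigcup_ge (R : realFieldType) (T I : finType) (A : I -> {set T})
    (c : R) (s : seq I) : uniq s -> 0 <= c ->
    (forall i j, i != j -> #|A i :&: A j|%:R <= c) ->
  \sum_(i <- s) #|A i|%:R <= #|\bigcup_(i <- s) A i|%:R + (size s ^ 2)%:R * c.
Proof.
move=> us c0 Ac; elim: s us => [_|i s IHs /= /andP[is_ us]].
  by rewrite !big_nil addr_ge0 ?mulr_ge0.
rewrite !big_cons.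
have {}IHs := IHs us.
have : #|A i :&: \bigcup_(j <- s) A j|%:R <= (size s)%:R * c.
  rewrite big_distrr /= {us IHs}; elim: s is_ => [_|j s IHs].
    by rewrite big_nil cards0 mul0r.
  rewrite inE negb_or => /andP[ij /IHs {}IHs]; rewrite big_cons /=.
  apply: (@le_trans _ _ (#|A i :&: A j|%:R + #|\bigcup_(j <- s) (A i :&: A j)|%:R)).
    by rewrite -natrD ler_nat cardsU leq_subr.
  by rewrite -addn1 addnC natrD mulrDl mul1r lerD // Ac.
have := cardsUI (A i) (\bigcup_(j <- s) A j) => /(congr1 (fun n => n%:R : R)).
rewrite !natrD => e1 e2.
have -> : ((size s).+1 ^ 2)%:R = (size s ^ 2)%:R + (size s)%:R *+ 2 + 1 :> R.
  by rewrite !natrX -natr1; ring.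
have sc : 0 <= (size s)%:R * c by rewrite mulr_ge0.
rewrite mulr2n; lra.
Qed.

Lemma card_bigcup_le (T I : finType) (P : pred I) (A : I -> {set T}) :
  (#|\bigcup_(i | P i) A i| <= \sum_(i | P i) #|A i|)%N.
Proof.
elim/big_rec2: _ => [|i m X _ IH]; first by rewrite cards0.
by rewrite (leq_trans (leq_card_setU _ _).1) // leq_add2l.
Qed.

Lemma bernoulli_ineq (R : realFieldType) (p : R) n :
  0 <= p <= 1 -> 1 - p * n%:R <= (1 - p) ^+ n.
Proof.
move=> /andP[p0 p1]; elim: n => [|n IHn]; first by rewrite expr0; lra.
rewrite exprS; apply: (le_trans (y := (1 - p) * (1 - p * n%:R))).
  rewrite -natr1; have : 0 <= p * p * n%:R by rewrite !mulr_ge0.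
  by lra.
by rewrite ler_wpM2l // subr_ge0.
Qed.

Lemma expr_le_add (R : realFieldType) (p Z : R) m n :
    0 <= p <= 1 -> 0 <= Z -> m%:R - n%:R <= Z ->
  (1 - p) ^+ n <= (1 - p) ^+ m + p * Z.
Proof.
move=> p01 Z0 mnZ; case/andP: (p01) => p0 p1.
have pZ : 0 <= p * Z by rewrite mulr_ge0.
have [mn|/ltnW nm] := leqP m n.
  have : (1 - p) ^+ n <= (1 - p) ^+ m.
    by rewrite -(subnK mn) exprD ler_piMl ?exprn_ge0 ?exprn_ile1 //; lra.
  lra.
rewrite -{1}(subnK nm) exprD.
have := bernoulli_ineq (m - n) p01; rewrite natrB // => H.
have a0 : 0 <= (1 - p) ^+ n by apply: exprn_ge0; lra.
have a1 : (1 - p) ^+ n <= 1 by apply: exprn_ile1; lra.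
have : (1 - p * (m%:R - n%:R)) * (1 - p) ^+ n <= (1 - p) ^+ (m - n) * (1 - p) ^+ n.
  by rewrite ler_wpM2r.
have : p * (m%:R - n%:R) * (1 - p) ^+ n <= p * Z.
  apply: (le_trans (y := p * (m%:R - n%:R))).
    by rewrite ler_piMr // mulr_ge0 // subr_ge0 ler_nat.
  by rewrite ler_wpM2l.
lra.
Qed.

Lemma natr_cards_sum (R : pzSemiRingType) (T : finType) (A : {set T}) (P : pred T) :
  #|[set x in A | P x]%SET|%:R = \sum_(x in A) (P x)%:R :> R.
Proof.
rewrite -sum1_card natr_sum; under eq_bigl do rewrite inE.
by rewrite big_mkcondr; apply: eq_bigr => x _; case: (P x).
Qed.

Lemma sumr_cards (R : pzSemiRingType) (T : finType) (A : {set T}) (c : R) :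
  \sum_(x in A) c = #|A|%:R * c.
Proof. by rewrite sumr_const mulr_natl. Qed.

Section Hypergraph.
Variables (R : realFieldType) (V E : finType) (B : E -> {set V}) (adj : rel E).

Definition star (F : {set E}) v := [set e in F | v \in B e].
Definition nbr (F : {set E}) e := [set e' in F | adj e e'].

Definition independent (M : {set E}) := {in M &, forall e e', e != e' -> ~~ adj e e'}.

(* [adj] contains the pairs of edges that meet; its other pairs are conflicts,
   of which every edge has few. *)
Definition near_regular (b : nat) (W : {set V}) (F : {set E}) (C D d : R) :=
  [/\ forall e, e \in F -> #|B e| = b /\ B e \subset W,
      forall v, #|star F v|%:R <= C * D,
      forall u v, u != v -> #|star F u :&: star F v|%:R <= d * D &
      forall e, e \in F ->
        #|[set e' in nbr F e | [disjoint B e & B e']]|%:R <= d * D].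

Definition irregularity (W : {set V}) (F : {set E}) (D : R) : R :=
  \sum_(v in W) `|#|star F v|%:R / D - 1|.

Lemma sum_star (f : V -> E -> R) (W : {set V}) (F : {set E}) :
    (forall e, e \in F -> B e \subset W) ->
  \sum_(v in W) \sum_(e in star F v) f v e = \sum_(e in F) \sum_(v in B e) f v e.
Proof.
move=> FW; rewrite (exchange_big_dep (mem F)) /=; last first.
  by move=> v e _; rewrite inE => /andP[].
apply: eq_bigr => e eF; apply: eq_bigl => v; rewrite inE eF /= andb_idl //.
by move/(subsetP (FW e eF)).
Qed.

(* AM-GM: [|y| <= tau + y ^+ 2 / tau]. *)
Lemma irregularity_le (W W0 : {set V}) (F : {set E}) (D tau : R) :
    0 < tau -> W \subset W0 ->
  irregularity W F D <= \sum_(v in W0)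
    (tau + tau^-1 * ((v \in W)%:R * (#|star F v|%:R / D - 1) ^+ 2)).
Proof.
move=> t0 WW0; rewrite (big_setID W) /= -[X in X <= _]addr0 lerD //; last first.
  apply: sumr_ge0 => v _; rewrite addr_ge0 ?(ltW t0) // mulr_ge0 ?invr_ge0 ?(ltW t0) //.
  by rewrite mulr_ge0 ?sqr_ge0.
rewrite (setIidPr WW0); apply: ler_sum => v vS; rewrite vS mul1r.
set y := _ - 1; rewrite -real_normK ?num_real //; move: `|y| (normr_ge0 y) => z z0.
rewrite -subr_ge0; have -> : tau + tau^-1 * z ^+ 2 - z
   = tau^-1 * ((tau - z) ^+ 2 + tau * z) by field; rewrite gt_eqF.
by rewrite mulr_ge0 ?invr_ge0 ?(ltW t0) // addr_ge0 ?sqr_ge0 // mulr_ge0 // ltW.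
Qed.

Section Bite.
Variables (b N : nat) (W : {set V}) (F : {set E}) (C D d theta : R).
Hypothesis adjC : symmetric adj.
Hypothesis adj_meet : forall e e', ~~ [disjoint B e & B e'] -> adj e e'.
Hypothesis b_gt0 : (0 < b)%N.
Hypothesis Fnear : near_regular b W F C D d.
Hypothesis C_ge1 : 1 <= C.
Hypothesis d_gt0 : 0 < d.
Hypothesis d_le1 : d <= 1.
Hypothesis dD_ge1 : 1 <= d * D.
Hypothesis theta_gt0 : 0 < theta.
Hypothesis theta_small : theta <= 4%:R^-1.
Hypothesis N_bounds : D <= N%:R <= D + 1.

(* Every edge is selected with probability [p]; a vertex of degree [D] survives
   with probability close to [q], and [D'] is the expected degree of a surviving
   vertex. [N] stands for [D] as a natural exponent. *)
Let p := theta / D.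
Let q := (1 - p) ^+ N.
Let x v : R := #|star F v|%:R / D.
Let h v : R := `|x v - 1|.
Let H e : R := \sum_(u in B e) h u.
Let xi := 4%:R * (b ^ 2)%:R * d.
Let D' := D * q ^+ b.-1.
Let W' (S : {set E}) := [set v in W | [disjoint star F v & S]].
Let F' (S : {set E}) := [set e in F | [disjoint nbr F e & S]].

Let D_ge1 : 1 <= D.
Proof.
rewrite (le_trans dD_ge1) // ler_piMl //.
by rewrite -(pmulr_rge0 _ d_gt0) (le_trans ler01).
Qed.

Let D_gt0 : 0 < D.
Proof. exact: lt_le_trans ltr01 D_ge1. Qed.

Let p01 : 0 <= p <= 1.
Proof.
rewrite divr_ge0 ?(ltW theta_gt0) ?(ltW D_gt0) //= ler_pdivrMr // mul1r.
by have := theta_small; have := D_ge1; lra.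
Qed.

Ltac local_lra := have := D_gt0; have := D_ge1; have := d_gt0; have := d_le1;
  have := dD_ge1; have := theta_gt0; have := theta_small; have := C_ge1; lra.

Let b_ge1 : (1 : R) <= b%:R.
Proof. by rewrite ler1n. Qed.

Let h_ge0 v : 0 <= h v. Proof. exact: normr_ge0. Qed.
Let H_ge0 e : 0 <= H e. Proof. exact: sumr_ge0. Qed.

Let d_le_xi : 2%:R * d <= xi.
Proof.
rewrite /xi ler_wpM2r ?(ltW d_gt0) // natrX expr2.
have : 1 * 1 <= b%:R * b%:R :> R by apply: ler_pM.
local_lra.
Qed.

Let starE v : #|star F v|%:R = x v * D.
Proof. by rewrite /x divfK // gt_eqF. Qed.

Let x_ge0 v : 0 <= x v.
Proof. by rewrite divr_ge0 // ltW. Qed.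

Let x_leC v : x v <= C.
Proof. by case: Fnear => _ deg _ _; rewrite ler_pdivrMr. Qed.

Lemma star_disjoint_pow (U : {set V}) :
  (1 - p) ^+ #|\bigcup_(u in U) star F u|
  <= q ^+ #|U| + \sum_(u in U) h u + (#|U| ^ 2 + #|U|)%:R * d.
Proof.
case: Fnear => _ _ codeg _; case/andP: N_bounds => _ ND.
have dD0 : 0 <= d * D by local_lra.
have := card_bigcup_ge (enum_uniq U) dD0 codeg; rewrite -cardE !big_enum /=.
move=> cupU.
have hU : 0 <= \sum_(u in U) h u by apply: sumr_ge0.
set Z := (\sum_(u in U) h u) * D + (#|U| ^ 2 + #|U|)%:R * (d * D).
have Z0 : 0 <= Z by rewrite addr_ge0 // mulr_ge0 // ltW.
have pZ : p * Z = theta * (\sum_(u in U) h u + (#|U| ^ 2 + #|U|)%:R * d).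
  by rewrite /p /Z; field; rewrite gt_eqF.
have s0 : 0 <= \sum_(u in U) h u + (#|U| ^ 2 + #|U|)%:R * d.
  by rewrite addr_ge0 // mulr_ge0 // ltW.
rewrite -addrA -exprM; apply: (le_trans (expr_le_add (m := (N * #|U|)%N) p01 Z0 _)).
  rewrite natrM.
  have : N%:R * #|U|%:R - \sum_(i in U) #|star F i|%:R
      <= (\sum_(u in U) h u) * D + #|U|%:R * (d * D) :> R.
    rewrite -[#|U|]sum1_card natr_sum mulr_sumr -sumrB mulr_suml mulr_suml -big_split.
    apply: ler_sum => u _ /=; rewrite starE mulr1 mul1r.
    have : 1 - x u <= h u by rewrite /h distrC ler_norm.
    move/(ler_wpM2r (ltW D_gt0)); local_lra.
  move: cupU; rewrite /Z natrD; local_lra.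
rewrite lerD2l pZ ler_piMl //; local_lra.
Qed.

Lemma card_nbr_le e : e \in F ->
  #|nbr F e|%:R <= \sum_(u in B e) #|star F u|%:R + d * D.
Proof.
case: Fnear => _ _ _ conf /[dup] eF /conf {}conf.
apply: le_trans (lerD (lexx _) conf); rewrite -natr_sum -natrD ler_nat.
apply: leq_trans (leq_add (card_bigcup_le _ _) (leqnn _)).
apply: leq_trans (leq_card_setU _ _).1; apply/subset_leq_card/subsetP => e'.
rewrite !inE => /andP[e'F ee'].
case: (boolP [disjoint B e & B e']) => [_|]; first by rewrite e'F ee' orbT.
rewrite -setI_eq0 => /set0Pn[u]; rewrite inE => /andP[ue ue'].
by apply/orP; left; apply/bigcupP; exists u; rewrite // inE e'F.
Qed.

Lemma nbr_pow e : e \in F -> q ^+ b <= (1 - p) ^+ #|nbr F e| + H e + d.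
Proof.
move=> eF; case: Fnear => /(_ e eF)[be _] _ _ _.
case/andP: N_bounds => DN _.
set Z := H e * D + d * D.
have Z0 : 0 <= Z by rewrite addr_ge0 // ?mulr_ge0 // ?ltW // mulr_gt0.
have pZ : p * Z = theta * (H e + d) by rewrite /p /Z; field; rewrite gt_eqF.
rewrite -addrA -exprM; apply: (le_trans (expr_le_add (m := #|nbr F e|) p01 Z0 _)).
  apply: (le_trans (lerB (card_nbr_le eF) (lexx _))).
  rewrite natrM -be -[#|B e|]sum1_card natr_sum mulr_sumr addrAC -sumrB lerD2r mulr_suml.
  apply: ler_sum => u _; rewrite starE mulr1.
  have : x u - 1 <= h u by rewrite /h ler_norm.
  move/(ler_wpM2r (ltW D_gt0)); local_lra.
rewrite lerD2l pZ ler_piMl ?addr_ge0 // ?ltW //; local_lra.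
Qed.

Let star_F' S v : #|star (F' S) v|%:R
  = \sum_(e in star F v) [disjoint nbr F e & S]%:R :> R.
Proof.
rewrite -natr_cards_sum; congr (_%:R); apply: eq_card => e.
by rewrite !inE andbAC.
Qed.

Let F'_W' S e v : e \in star F v -> v \notin W' S -> v \in W ->
  [disjoint nbr F e & S] = false.
Proof.
rewrite !inE => /andP[eF ve] + vW; rewrite vW /= => /pred0Pn[e'] /=.
rewrite inE => /andP[/andP[e'F ve'] e'S]; apply/negbTE/pred0Pn; exists e' => /=.
rewrite inE e'F e'S andbT adj_meet //; apply/pred0Pn; exists v => /=.
by rewrite ve ve'.
Qed.

Let P0 : R := 2%:R ^+ b.-1.
Let G v : R := (\sum_(e in star F v) H e) / D.

Let q_ge : 2%:R^-1 <= q.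
Proof.
case/andP: N_bounds => _ ND; apply: le_trans (bernoulli_ineq N p01).
have : p * N%:R <= p * (D + 1) by rewrite ler_wpM2l //; case/andP: p01.
have -> : p * (D + 1) = theta + theta / D by rewrite /p; field; rewrite gt_eqF.
have : theta / D <= theta by rewrite ler_pdivrMr // ler_peMr // ltW.
local_lra.
Qed.

Let q_gt0 : 0 < q. Proof. by apply: lt_le_trans q_ge; rewrite invr_gt0. Qed.
Let q_le1 : q <= 1.
Proof. by case/andP: p01 => p0 p1; rewrite exprn_ile1 // ?subr_ge0 // gerBl. Qed.

Let Q_inv : 1 <= (q ^+ b.-1)^-1 <= P0.
Proof.
rewrite -exprVn /P0 exprn_ege1 ?invf_ge1 //=.
by rewrite lerXn2r ?nnegrE ?invr_ge0 // ?(ltW q_gt0) // invf_ple ?posrE.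
Qed.

Let D'_gt0 : 0 < D'. Proof. by rewrite mulr_gt0 // exprn_gt0. Qed.

Lemma expect_irregularity v : v \in W ->
  expect p (fun S => (v \in W' S)%:R * (#|star (F' S) v|%:R / D' - 1) ^+ 2)
  <= (C + 1) * h v + 4%:R * P0 ^+ 2 * C * G v + 5%:R * P0 ^+ 2 * C ^+ 2 * xi.
Proof.
move=> vW; case: (Fnear) => FB _ codeg _.
have eX S : (v \in W' S)%:R * (#|star (F' S) v|%:R / D' - 1) ^+ 2 =
    D' ^- 2 * (\sum_(e in star F v) \sum_(e' in star F v)
                 [disjoint nbr F e :|: nbr F e' & S]%:R)
    - 2%:R / D' * (\sum_(e in star F v) [disjoint nbr F e & S]%:R)
    + [disjoint star F v & S]%:R.
  have -> : \sum_(e in star F v) \sum_(e' in star F v)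
                 [disjoint nbr F e :|: nbr F e' & S]%:R = #|star (F' S) v|%:R ^+ 2 :> R.
    rewrite star_F' expr2 mulr_suml; apply: eq_bigr => e _; rewrite mulr_sumr.
    by apply: eq_bigr => e' _; rewrite -natrM mulnb -!setI_eq0 setIUl setU_eq0.
  rewrite -star_F'; case: (boolP (v \in W' S)) => vS.
    have -> : [disjoint star F v & S] by move: vS; rewrite inE => /andP[].
    by rewrite /=; field; rewrite gt_eqF.
  have -> : [disjoint star F v & S] = false.
    by apply: negbTE; move: vS; rewrite inE vW.
  rewrite star_F' big1 => [|e ev]; first by rewrite /= !expr2; ring.
  by rewrite (F'_W' ev vS vW).
have -> : expect p (fun S => (v \in W' S)%:R * (#|star (F' S) v|%:R / D' - 1) ^+ 2)
   = D' ^- 2 * (\sum_(e in star F v) \sum_(e' in star F v)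
                 (1 - p) ^+ #|nbr F e :|: nbr F e'|)
    - 2%:R / D' * (\sum_(e in star F v) (1 - p) ^+ #|nbr F e|)
    + (1 - p) ^+ #|star F v|.
  have -> : expect p (fun S => (v \in W' S)%:R * (#|star (F' S) v|%:R / D' - 1) ^+ 2)
    = expect p (fun S => D' ^- 2 * (\sum_(e in star F v) \sum_(e' in star F v)
                 [disjoint nbr F e :|: nbr F e' & S]%:R)
    - 2%:R / D' * (\sum_(e in star F v) [disjoint nbr F e & S]%:R)
    + [disjoint star F v & S]%:R) by apply: eq_bigr => S _; rewrite eX.
  rewrite expectD expectB !expectZ expect_disjoint !expect_sum.
  congr (_ * _ - _ * _ + _); apply: eq_bigr => e _; last by rewrite expect_disjoint.
  by rewrite expect_sum; apply: eq_bigr => e' _; rewrite expect_disjoint.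
have xi0 : 0 <= xi by have := d_le_xi; local_lra.
have star1 : (1 - p) ^+ #|star F v| <= q + h v + xi.
  have := star_disjoint_pow [set v]%SET.
  rewrite big_set1 big_set1 cards1 expr1 => /le_trans -> //.
  by rewrite lerD2l.
have pair e e' : e \in star F v -> e' \in star F v ->
   (1 - p) ^+ #|nbr F e :|: nbr F e'|
   <= q ^+ (b + b.-1) + H e + H e' + xi + (B e :&: B e' != [set v]%SET)%:R.
  rewrite !inE => /andP[eF ve] /andP[e'F ve'].
  case/andP: (p01) => p0 p1.
  have s0 : 0 <= q ^+ (b + b.-1) + H e + H e' + xi.
    have := exprn_ge0 (b + b.-1) (ltW q_gt0); have := H_ge0 e; have := H_ge0 e'.
    by move: xi0; lra.
  have [cap|_] := eqVneq (B e :&: B e') [set v]%SET; last first.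
    apply: (@le_trans _ _ 1); last by rewrite /= lerDr.
    by rewrite exprn_ile1 // ?subr_ge0 // gerBl.
  rewrite /= addr0; have [be _] := FB e eF; have [be' _] := FB e' e'F.
  have cU : #|B e :|: B e'| = (b + b.-1)%N.
    by rewrite cardsU be be' cap cards1 -subn1 addnBA.
  apply: (le_trans (y := (1 - p) ^+ #|\bigcup_(u in B e :|: B e') star F u|)).
    rewrite ler_wiXn2l ?subr_ge0 // ?gerBl //; apply/subset_leq_card/subsetP => f.
    case/bigcupP => u; rewrite !inE => ue /andP[fF uf]; rewrite fF /=.
    have meet g : u \in B g -> adj g f.
      by move=> ug; apply/adj_meet/pred0Pn; exists u; rewrite /= ug.
    by case/orP: ue => /meet ->; rewrite ?orbT.
  apply: le_trans (star_disjoint_pow _) _; rewrite cU.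
  have : \sum_(u in B e :|: B e') h u <= H e + H e'.
    have HE f : H f = \sum_u (if u \in B f then h u else 0) by rewrite /H big_mkcond.
    rewrite !HE big_mkcond -big_split /=.
    apply: ler_sum => u _; rewrite inE; have := h_ge0 u.
    by case: (u \in B e); case: (u \in B e') => /=; lra.
  have : ((b + b.-1) ^ 2 + (b + b.-1))%:R * d <= xi.
    rewrite /xi -natrM ler_wpM2r ?(ltW d_gt0) // ler_nat; clear -b_gt0.
    by case: b b_gt0 => // m _; rewrite !expnS !expn0 /=; lia.
  lra.
set n : R := #|star F v|%:R; set Hs := \sum_(e in star F v) H e.
have sumc (c : R) : \sum_(e in star F v) c = n * c by exact: sumr_cards.
have pairs : \sum_(e in star F v) \sum_(e' in star F v)
     (1 - p) ^+ #|nbr F e :|: nbr F e'|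
   <= n * n * (q ^+ (b + b.-1) + xi) + 2%:R * n * Hs + n * (b%:R * (d * D)).
  have bad e : e \in star F v ->
     \sum_(e' in star F v) (B e :&: B e' != [set v]%SET)%:R <= b%:R * (d * D).
    rewrite inE => /andP[eF ve]; have [be _] := FB e eF.
    rewrite -natr_cards_sum.
    apply: (le_trans (y := (\sum_(u in B e :\ v) #|star F v :&: star F u|)%:R)).
      rewrite ler_nat; apply: leq_trans (card_bigcup_le _ _).
      apply/subset_leq_card/subsetP => f; rewrite !inE => /andP[/andP[fF vf] cap].
      have /subsetPn[u] : ~~ (B e :&: B f \subset [set v]).
        apply: contra cap => sub; rewrite eqEsubset sub.
        by apply/subsetP => u; rewrite !inE => /eqP ->; rewrite ve vf.
      rewrite !inE => /andP[ue uf] uv; apply/bigcupP; exists u.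
        by rewrite !inE uv.
      by rewrite !inE fF vf uf.
    rewrite natr_sum -be -[#|B e|]sum1_card natr_sum mulr_suml.
    rewrite (big_setD1 v ve) /= -[X in X <= _]add0r lerD //.
      by rewrite mul1r; local_lra.
    apply: ler_sum => u; rewrite !inE => /andP[uv _]; rewrite mul1r codeg //.
    by rewrite eq_sym.
  have -> : n * n * (q ^+ (b + b.-1) + xi) + 2%:R * n * Hs + n * (b%:R * (d * D)) =
    \sum_(e in star F v) (n * (q ^+ (b + b.-1) + xi) + n * H e + Hs + b%:R * (d * D)).
    by rewrite !big_split /= !sumc -mulr_sumr -/Hs; ring.
  apply: ler_sum => e ev.
  apply: (le_trans (ler_sum _ (fun e' e'v => pair e e' ev e'v))).
  rewrite !big_split /= !sumc -/Hs.
  have := bad e ev; lra.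
have singles : n * q ^+ b - Hs - n * xi <= \sum_(e in star F v) (1 - p) ^+ #|nbr F e|.
  have -> : n * q ^+ b - Hs - n * xi = \sum_(e in star F v) (q ^+ b - H e - xi).
    by rewrite !sumrB !sumc.
  apply: ler_sum => e; rewrite inE => /andP[eF _]; have := nbr_pow eF.
  have := d_le_xi; local_lra.
have D'2 : 0 <= D' ^- 2 by rewrite invr_ge0 exprn_ge0 // ltW.
have D'1 : 0 <= 2%:R / D' by rewrite divr_ge0 // ltW.
have := ler_wpM2l D'2 pairs; have := ler_wpM2l D'1 singles.
set P := (q ^+ b.-1)^-1.
have nE : n = x v * D by rewrite /n starE.
have HsE : Hs = G v * D by rewrite /G divfK // gt_eqF.
have -> : D' ^- 2 * (n * n * (q ^+ (b + b.-1) + xi) + 2%:R * n * Hs + n * (b%:R * (d * D)))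
  = x v ^+ 2 * q + P ^+ 2 * (x v ^+ 2 * xi + 2%:R * x v * G v + x v * (b%:R * d)).
  rewrite nE HsE /D' /P; have -> : q ^+ (b + b.-1) = q * q ^+ b.-1 ^+ 2.
    by case: b b_gt0 => // m _ /=; rewrite exprD exprS; ring.
  have : q ^+ b.-1 != 0 by rewrite expf_neq0 // gt_eqF.
  by move: (q ^+ b.-1) => Q Q0; field; rewrite Q0 gt_eqF.
have -> : 2%:R / D' * (n * q ^+ b - Hs - n * xi)
  = 2%:R * x v * q - 2%:R * P * (G v + x v * xi).
  rewrite nE HsE /D' /P; have -> : q ^+ b = q * q ^+ b.-1.
    by case: b b_gt0 => // m _ /=; rewrite exprS.
  have : q ^+ b.-1 != 0 by rewrite expf_neq0 // gt_eqF.
  by move: (q ^+ b.-1) => Q Q0; field; rewrite Q0 gt_eqF.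
move: star1; set S2 := D' ^- 2 * _; set S1 := 2%:R / D' * _; set S0 := _ ^+ #|_|.
have G0 : 0 <= G v by rewrite divr_ge0 ?sumr_ge0 // ltW.
have bxi : b%:R * d <= xi.
  rewrite /xi ler_wpM2r ?(ltW d_gt0) // -natrM ler_nat; clear -b_gt0.
  by rewrite (leq_trans (leq_pmulr b b_gt0)) // -mulnn leq_pmull.
have bd0 : 0 <= b%:R * d by rewrite mulr_ge0 // ltW.
case/andP: Q_inv; rewrite -/P => P_ge1 P_le.
have := x_ge0 v; have := x_leC v; have := h_ge0 v.
have hsq : (x v - 1) ^+ 2 = h v ^+ 2 by rewrite /h real_normK ?num_real.
have hC : h v <= C.
  by rewrite /h ler_norml; have := x_leC v; have := x_ge0 v; local_lra.
move: (C_ge1) (xi0) (q_le1) (q_gt0) hsq hC G0 bxi bd0 => {xi0}.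
move: (h v) (x v) (G v) (P0) (P) P_ge1 P_le (xi) (b%:R * d) (q) (C) (S0) (S1) (S2).
move=> hv xv g p0 P1 P1_ge1 P1_le xi' bd q' C' S0' S1' S2'.
move=> C1 xi0 q1 q0 hsq hC g0 bxi bd0 hv0 xC xv0 s0 s1 s2.
have P2 : P1 ^+ 2 <= p0 ^+ 2 by rewrite lerXn2r ?nnegrE; lra.
have P1p : P1 <= p0 ^+ 2.
  by apply: le_trans P2; rewrite expr2 ler_peMr //; lra.
have p02 : 1 <= p0 ^+ 2 by lra.
have e1 : q' * (xv - 1) ^+ 2 <= C' * hv.
  rewrite hsq; apply: (le_trans (y := hv ^+ 2)); first by rewrite ler_piMl // sqr_ge0.
  by rewrite expr2 ler_wpM2r.
have xC2 : xv <= C' ^+ 2.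
  by apply: (le_trans xC); rewrite expr2 ler_peMr //; lra.
have C2 : 1 <= C' ^+ 2 by rewrite exprn_ege1.
have e2 : P1 ^+ 2 * (xv ^+ 2 * xi' + 2%:R * xv * g + xv * bd)
   <= p0 ^+ 2 * (C' ^+ 2 * xi' + 2%:R * C' * g + C' ^+ 2 * xi').
  apply: ler_pM => //; first exact: sqr_ge0.
  - by rewrite !addr_ge0 ?mulr_ge0 // sqr_ge0.
  - rewrite !lerD // ?ler_wpM2r //.
    + by rewrite lerXn2r ?nnegrE //; lra.
    + lra.
    + apply: (le_trans (y := xv * xi')); first by rewrite ler_wpM2l.
      by rewrite ler_wpM2r.
have e3 : 2%:R * P1 * (g + xv * xi') <= 2%:R * p0 ^+ 2 * (C' * g + C' ^+ 2 * xi').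
  apply: ler_pM => //; rewrite ?mulr_ge0 ?addr_ge0 ?mulr_ge0 //; try lra.
  rewrite lerD ?ler_wpM2r //; first by rewrite ler_peMl.
have e4 : xi' <= p0 ^+ 2 * C' ^+ 2 * xi'.
  by rewrite ler_peMl // -[1]mulr1 ler_pM.
lra.
Qed.

Lemma expect_irregularity_sum :
  \sum_(v in W) expect p
    (fun S => (v \in W' S)%:R * (#|star (F' S) v|%:R / D' - 1) ^+ 2)
  <= (C + 1 + 4%:R * P0 ^+ 2 * C ^+ 2 * b%:R) * irregularity W F D
     + 5%:R * P0 ^+ 2 * C ^+ 2 * xi * #|W|%:R.
Proof.
case: (Fnear) => FB _ _ _.
have FW e : e \in F -> B e \subset W by case/FB.
apply: (le_trans (ler_sum _ expect_irregularity)).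
rewrite !big_split /= sumr_cards -!mulr_sumr.
rewrite [X in _ <= _ + X]mulrC lerD2r [X in _ <= X]mulrDl lerD2l.
have -> : \sum_(v in W) G v = b%:R * \sum_(v in W) (x v * h v).
  rewrite -mulr_suml (sum_star (fun _ e => H e)) //.
  have -> : \sum_(v in W) x v * h v = \sum_(v in W) (\sum_(e in star F v) h v / D).
    apply: eq_bigr => v _; rewrite sumr_cards starE.
    by field; rewrite gt_eqF.
  rewrite (sum_star (fun v _ => h v / D)) // mulr_suml mulr_sumr.
  apply: eq_bigr => e eF; rewrite sumr_cards (FB e eF).1.
  by rewrite -mulr_suml mulrA.
have -> : 4%:R * P0 ^+ 2 * C ^+ 2 * b%:R * irregularity W F D
    = 4%:R * P0 ^+ 2 * C * (b%:R * (C * irregularity W F D)) by ring.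
rewrite ler_wpM2l //; first by rewrite !mulr_ge0 ?exprn_ge0 // ltW // (lt_le_trans ltr01).
rewrite ler_wpM2l // mulr_sumr; apply: ler_sum => v _.
by rewrite ler_wpM2r // h_ge0.
Qed.

Let M0 (S : {set E}) := [set e in F | (e \in S) && [disjoint nbr F e :\ e & S]].

Lemma expect_selected :
  \sum_(v in W) (theta * x v - b%:R * theta ^+ 2 * x v ^+ 2 - theta ^+ 2 * d * x v)
  <= b%:R * expect p (fun S => #|M0 S|%:R).
Proof.
case: (Fnear) => FB _ _ _; case/andP: (p01) => p0 p1.
have FW e : e \in F -> B e \subset W by case/FB.
have -> : expect p (fun S => #|M0 S|%:R)
    = \sum_(e in F) p * (1 - p) ^+ #|nbr F e :\ e|.
  rewrite /expect; under eq_bigr do rewrite natr_cards_sum.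
  rewrite -/(expect p _) expect_sum; apply: eq_bigr => e _.
  rewrite -[X in X * _]expr1 -(cards1 e) -expect_in_out.
    by apply: eq_bigr => S _; rewrite sub1set.
  by rewrite disjoints_subset sub1set !inE eqxx.
have lb e : e \in F -> p * (1 - p * (\sum_(u in B e) x u * D + d * D))
    <= p * (1 - p) ^+ #|nbr F e :\ e|.
  move=> eF; rewrite ler_wpM2l //; apply: le_trans (bernoulli_ineq _ p01).
  rewrite lerD2l lerN2 ler_wpM2l //; under eq_bigr do rewrite -starE.
  apply: le_trans (card_nbr_le eF); rewrite ler_nat.
  by apply/subset_leq_card/subD1set.
apply: le_trans (ler_wpM2l (ltW (lt_le_trans ltr01 b_ge1)) (ler_sum _ lb)).
have -> : b%:R * (\sum_(e in F) p * (1 - p * (\sum_(u in B e) x u * D + d * D)))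
  = \sum_(e in F) \sum_(v in B e)
      p * (1 - theta * d - b%:R * theta * x v).
  rewrite mulr_sumr; apply: eq_bigr => e eF.
  rewrite -mulr_sumr sumrB sumr_cards (FB e eF).1 -mulr_sumr -mulr_suml /p.
  by field; rewrite gt_eqF.
rewrite -(sum_star (fun v _ => _) FW); apply: ler_sum => v _; rewrite sumr_cards starE /p.
rewrite le_eqVlt; apply/orP; left; apply/eqP; field.
by rewrite gt_eqF.
Qed.

Lemma expect_surviving :
  \sum_(v in W) (1 - theta * x v) <= expect p (fun S => #|W' S|%:R).
Proof.
rewrite /expect; under [leRHS]eq_bigr do rewrite natr_cards_sum.
rewrite -/(expect p _) expect_sum; apply: ler_sum => v _; rewrite expect_disjoint.
apply: le_trans (bernoulli_ineq _ p01); rewrite starE /p.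
rewrite le_eqVlt; apply/orP; left; apply/eqP; field.
by rewrite gt_eqF.
Qed.

Let L : R := C + 1 + 4%:R * P0 ^+ 2 * C ^+ 2 * b%:R.
Let L' : R := 5%:R * P0 ^+ 2 * C ^+ 2 * xi.

Lemma exists_bite (g K tau : R) : 0 <= g <= 1 -> 0 <= K -> 0 < tau -> exists S,
  (1 - g + g * theta - b%:R * theta ^+ 2 - C * d - K * (tau + L' / tau)) * #|W|%:R
    - (1 + b%:R * (C + 1) + K * (L / tau)) * irregularity W F D
  <= b%:R * #|M0 S|%:R + ((1 - g) * #|W' S|%:R - K * irregularity (W' S) (F' S) D').
Proof.
move=> /andP[g0 g1] K0 t0.
pose Y v (S : {set E}) := (v \in W' S)%:R * (#|star (F' S) v|%:R / D' - 1) ^+ 2.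
pose f S := b%:R * #|M0 S|%:R + ((1 - g) * #|W' S|%:R
   - K * (tau * #|W|%:R + tau^-1 * \sum_(v in W) Y v S)).
have irrY S : irregularity (W' S) (F' S) D' <= tau * #|W|%:R + tau^-1 * \sum_(v in W) Y v S.
  apply: le_trans (irregularity_le _ _ t0 (_ : W' S \subset W)) _.
    by apply/subsetP => v; rewrite inE => /andP[].
  by rewrite big_split /= sumr_cards -mulr_sumr [_ * tau]mulrC.
have [S fS] := expect_attained p01 f; exists S.
apply: le_trans (_ : f S <= _); last by rewrite lerD2l lerD2l lerN2 ler_wpM2l.
apply: le_trans fS.
have -> : expect p f = b%:R * expect p (fun S => #|M0 S|%:R)
  + ((1 - g) * expect p (fun S => #|W' S|%:R)
     - K * (tau * #|W|%:R + tau^-1 * \sum_(v in W) expect p (Y v))).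
  rewrite /f expectD expectB !expectZ expectD !expectZ expect_sum.
  congr (_ + (_ - _ * (_ * _ + _))).
  by rewrite /expect -mulr_suml bernoulli_sum1 mul1r.
have g1' : 0 <= 1 - g by lra.
apply: le_trans (lerD expect_selected (lerB (ler_wpM2l g1' expect_surviving) (lexx _))).
have tK : 0 <= K * tau^-1 by rewrite mulr_ge0 // invr_ge0 ltW.
have := ler_wpM2l tK expect_irregularity_sum; rewrite -/L -/L' => Ysum.
have xsum : (1 - g + g * theta - b%:R * theta ^+ 2 - C * d) * #|W|%:R
    - (1 + b%:R * (C + 1)) * irregularity W F D
  <= \sum_(v in W) (theta * x v - b%:R * theta ^+ 2 * x v ^+ 2 - theta ^+ 2 * d * x v)
     + (1 - g) * \sum_(v in W) (1 - theta * x v).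
  rewrite [X in X - _]mulrC -sumr_cards !mulr_sumr -sumrB -big_split /=.
  apply: ler_sum => v _; rewrite -/(x v) -/(h v).
  have h1 : 1 - h v <= x v by rewrite lerBlDl -lerBlDr /h distrC ler_norm.
  have h2 : x v ^+ 2 <= 1 + (C + 1) * h v.
    have : (x v - 1) * (x v + 1) <= h v * (C + 1).
      apply: (le_trans (y := h v * (x v + 1))).
        by rewrite ler_wpM2r ?addr_ge0 // ler_norm.
      by rewrite ler_wpM2l ?h_ge0 // lerD2r.
    lra.
  have t2 : theta ^+ 2 <= 1 by rewrite exprn_ile1 //; local_lra.
  have e1 : g * theta * (1 - h v) <= g * theta * x v.
    by rewrite ler_wpM2l // mulr_ge0 // ltW.
  have e2 : g * theta * h v <= h v.
    by rewrite ler_piMl ?h_ge0 // -[1]mulr1 ler_pM //; local_lra.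
  have e3 : b%:R * theta ^+ 2 * x v ^+ 2 <= b%:R * theta ^+ 2 * (1 + (C + 1) * h v).
    by rewrite ler_wpM2l // mulr_ge0 // sqr_ge0.
  have e4 : b%:R * theta ^+ 2 * ((C + 1) * h v) <= b%:R * ((C + 1) * h v).
    rewrite -mulrA ler_wpM2l // ler_piMl // mulr_ge0 ?h_ge0 //; local_lra.
  have e5 : theta ^+ 2 * d * x v <= C * d.
    have dx : d * x v <= C * d by rewrite mulrC ler_wpM2r // ltW.
    have : theta ^+ 2 * (d * x v) <= d * x v by rewrite ler_piMl // mulr_ge0 // ltW.
    lra.
  lra.
lra.
Qed.

Let D_le : D <= P0 * D'.
Proof.
have Q0 : q ^+ b.-1 != 0 by rewrite expf_neq0 // gt_eqF.
rewrite -[leLHS](mulfK Q0) [leRHS]mulrC ler_wpM2l ?(ltW D'_gt0) //.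
by case/andP: Q_inv.
Qed.

Let F'_sub S : F' S \subset F.
Proof. by apply/subsetP => e; rewrite inE => /andP[]. Qed.

Lemma bite_near_regular S d1 : d * P0 <= d1 ->
  near_regular b (W' S) (F' S) (C * P0) D' d1.
Proof.
move=> dd1; case: (Fnear) => FB deg codeg conf.
have dD' : d * D <= d1 * D'.
  apply: (le_trans (y := d * (P0 * D'))); first by rewrite ler_wpM2l // ltW.
  by rewrite mulrA ler_wpM2r // ltW.
have starS v : star (F' S) v \subset star F v.
  by apply/subsetP => e; rewrite !inE => /andP[/andP[-> _] ->].
split.
- move=> e eS; have eF := subsetP (F'_sub S) e eS; have [be BW] := FB e eF.
  split=> //; apply/subsetP => v ve; have vW := subsetP BW v ve.
  have ev : e \in star F v by rewrite inE eF.
  apply/negPn/negP => vS; have := F'_W' ev vS vW.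
  by move: eS; rewrite inE => /andP[_ ->].
- move=> v; apply: (le_trans (y := #|star F v|%:R)).
    by rewrite ler_nat subset_leq_card.
  apply: le_trans (deg v) _; rewrite -mulrA ler_wpM2l //.
  by apply: le_trans C_ge1.
- move=> u v uv; apply: le_trans dD'; apply: le_trans (codeg u v uv).
  by rewrite ler_nat subset_leq_card // setISS.
- move=> e eS; have eF := subsetP (F'_sub S) e eS.
  apply: le_trans dD'; apply: le_trans (conf e eF).
  rewrite ler_nat; apply/subset_leq_card/subsetP => f; rewrite !inE.
  by move=> /andP[/andP[/andP[-> _] ->] ->].
Qed.

Lemma bite_independent S (M : {set E}) : M \subset F' S -> independent M ->
  [/\ M0 S :|: M \subset F, independent (M0 S :|: M) &
      #|M0 S :|: M| = (#|M0 S| + #|M|)%N].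
Proof.
move=> MF' indM; case: (Fnear) => FB _ _ _.
have M0F : M0 S \subset F by apply/subsetP => e; rewrite inE => /andP[].
have M0S e f : e \in M0 S -> f \in F' S -> ~~ adj f e.
  rewrite !inE => /andP[eF /andP[eS _]] /andP[_ fS]; apply/negP => fe.
  by have := disjointFl fS eS; rewrite inE eF fe.
split.
- by rewrite subUset M0F (subset_trans MF') // F'_sub.
- move=> e f; rewrite !in_setU => /orP[eM|eM] /orP[fM|fM] ef.
  + move: eM fM; rewrite !inE => /andP[eF /andP[eS de]] /andP[fF /andP[fS _]].
    by apply/negP => aef; have := disjointFl de fS; rewrite !inE eq_sym ef fF aef.
  + by rewrite adjC (M0S e f eM (subsetP MF' f fM)).
  + exact: M0S fM (subsetP MF' e eM).
  + exact: indM.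
- rewrite cardsU; suff -> : M0 S :&: M = set0 by rewrite cards0 subn0.
  apply/setP => e; rewrite in_setI [RHS]inE; apply/negbTE/negP => /andP[eM0 eM].
  have := M0S e e eM0 (subsetP MF' e eM); rewrite adj_meet //.
  rewrite -setI_eq0 setIid -card_gt0.
  by rewrite (FB e (subsetP M0F e eM0)).1.
Qed.

Lemma nibble_bite (g K tau d1 : R) :
  0 <= g <= 1 -> 0 <= K -> 0 < tau -> d * 2%:R ^+ b.-1 <= d1 ->
  exists (W1 : {set V}) (F1 M1 : {set E}) (D1 : R),
    [/\ 1 <= d1 * D1, near_regular b W1 F1 (C * 2%:R ^+ b.-1) D1 d1,
    forall M : {set E}, M \subset F1 -> independent M ->
      [/\ M1 :|: M \subset F, independent (M1 :|: M) & #|M1 :|: M| = (#|M1| + #|M|)%N]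
    & (1 - g + g * theta - b%:R * theta ^+ 2 - C * d -
         K * (tau + 5%:R * (2%:R ^+ b.-1) ^+ 2 * C ^+ 2 * (4%:R * (b ^ 2)%:R * d) / tau))
      * #|W|%:R
      - (1 + b%:R * (C + 1)
         + K * ((C + 1 + 4%:R * (2%:R ^+ b.-1) ^+ 2 * C ^+ 2 * b%:R) / tau))
        * irregularity W F D
      <= b%:R * #|M1|%:R + ((1 - g) * #|W1|%:R - K * irregularity W1 F1 D1)].
Proof.
move=> g01 K0 t0 dd1; have [S HS] := exists_bite g01 K0 t0.
exists (W' S), (F' S), (M0 S), D'; split => //.
- apply: (le_trans dD_ge1); apply: (le_trans (y := d * (P0 * D'))).
    by rewrite ler_wpM2l // ltW.
  by rewrite mulrA ler_wpM2r // ltW.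
- exact: bite_near_regular.
- exact: bite_independent.
Qed.

End Bite.
End Hypergraph.

Definition packable (R : realFieldType) (b : nat) (g : R) : Prop :=
  forall C : R, 1 <= C -> exists K d : R, [/\ 0 <= K, 0 < d &
    forall (V E : finType) (B : E -> {set V}) (adj : rel E)
           (W : {set V}) (F : {set E}) (D : R),
    symmetric adj -> (forall e e', ~~ [disjoint B e & B e'] -> adj e e') ->
    near_regular B adj b W F C D d -> 1 <= d * D ->
    exists M : {set E}, [/\ M \subset F, independent adj M &
      (1 - g) * #|W|%:R - K * irregularity B W F D <= b%:R * #|M|%:R]].

Lemma packable1 (R : realFieldType) (b : nat) : packable b (1 : R).
Proof.
move=> C _; exists 0, 1; split=> // V E B adj W F D _ _ _ _.
exists set0; split; first exact: sub0set.
  by move=> e e'; rewrite inE.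
by rewrite cards0 subrr !mul0r subrr mulr0.
Qed.

Lemma packable_step (R : archiRealFieldType) (b : nat) (g theta : R) :
    (0 < b)%N -> 0 <= g <= 1 -> 0 < theta <= 4%:R^-1 -> packable b g ->
  packable b (g * (1 - theta) + 2%:R * b%:R * theta ^+ 2).
Proof.
move=> b0 g01 /andP[t0 t4] packg C C1.
set P0 : R := 2%:R ^+ b.-1.
have P0_ge1 : 1 <= P0 by rewrite exprn_ege1 // ler1n.
have CP : 1 <= C * P0 by rewrite -[1]mulr1 ler_pM.
have [K [d1 [K0 d1_gt0 pack]]] := packg _ CP.
have b1 : 1 <= b%:R :> R by rewrite ler1n.
set beta := b%:R * theta ^+ 2 / 3%:R.
have beta0 : 0 < beta by rewrite divr_gt0 // mulr_gt0 ?exprn_gt0 //; lra.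
have K1 : 0 < K + 1 by lra.
set tau := beta / (K + 1); have tau0 : 0 < tau by rewrite divr_gt0.
set L2 := 5%:R * P0 ^+ 2 * C ^+ 2 * (4%:R * (b ^ 2)%:R).
have L20 : 0 < L2.
  have b20 : 0 < (b ^ 2)%:R :> R by rewrite ltr0n expn_gt0 b0.
  by rewrite !mulr_gt0 ?exprn_gt0 //; lra.
pose d := Num.min (Num.min 1 (d1 / P0)) (Num.min (beta / C) (beta * tau / ((K + 1) * L2))).
have d0 : 0 < d.
  have C0 : 0 < C by lra.
  have P00 : 0 < P0 by lra.
  rewrite !lt_min ltr01 (divr_gt0 d1_gt0 P00) (divr_gt0 beta0 C0) /=.
  exact: divr_gt0 (mulr_gt0 beta0 tau0) (mulr_gt0 K1 L20).
have [dl1 dP dbC dbt] : [/\ d <= 1, d <= d1 / P0, d <= beta / C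
    & d <= beta * tau / ((K + 1) * L2)].
  by split; rewrite /d !ge_min lexx ?orbT.
have dd1 : d * P0 <= d1.
  by rewrite -ler_pdivlMr ?(lt_le_trans ltr01 P0_ge1).
have dC : C * d <= beta.
  by rewrite mulrC -ler_pdivlMr ?(lt_le_trans ltr01 C1).
have dK : K * (L2 * d / tau) <= beta.
  apply: (le_trans (y := (K + 1) * (L2 * d / tau))).
    rewrite ler_wpM2r ?lerDl //.
    exact: divr_ge0 (mulr_ge0 (ltW L20) (ltW d0)) (ltW tau0).
  rewrite mulrA ler_pdivrMr //; move: dbt; rewrite (ler_pdivlMr _ _ (mulr_gt0 K1 L20)).
  by rewrite [leLHS]mulrC -mulrA.
have tK : K * tau <= beta.
  by rewrite /tau mulrA ler_pdivrMr // mulrC ler_pM2l // lerDl.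
exists (1 + b%:R * (C + 1) + K * ((C + 1 + 4%:R * P0 ^+ 2 * C ^+ 2 * b%:R) / tau)), d.
split=> //.
  have bC : 0 <= b%:R * (C + 1) by rewrite mulr_ge0 //; lra.
  have L0 : 0 <= 4%:R * P0 ^+ 2 * C ^+ 2 * b%:R.
    have P00 : 0 <= P0 by lra.
    have C0 : 0 <= C by lra.
    by rewrite !mulr_ge0 ?exprn_ge0.
  have : 0 <= K * ((C + 1 + 4%:R * P0 ^+ 2 * C ^+ 2 * b%:R) / tau).
    by apply: mulr_ge0 => //; apply: divr_ge0 (ltW tau0); lra.
  lra.
move=> V E B adj W F D adjC adj_meet Fnear dD.
have D0 : 0 <= D by rewrite -(pmulr_rge0 _ d0) (le_trans ler01).
have N_bounds : D <= (Num.truncn D).+1%:R <= D + 1.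
  have /andP[l u] := truncn_itv D0; rewrite (ltW u) /=.
  by rewrite -natr1 lerD2r.
have [W1 [F1 [M1 [D1 [dD1 near1 ext ineq]]]]] :=
  nibble_bite adjC adj_meet b0 Fnear C1 d0 dl1 dD t0 t4 N_bounds g01 K0 tau0 dd1.
have [M [MF1 indM cM]] := pack V E B adj W1 F1 D1 adjC adj_meet near1 dD1.
have [MF ind cM1] := ext M MF1 indM; exists (M1 :|: M); split=> //.
rewrite cM1 natrD [leRHS]mulrDr; 
apply: (le_trans _ (lerD (lexx _) cM)); apply: (le_trans _ ineq).
rewrite lerD2r ler_wpM2r // -/P0.
have -> : 5%:R * P0 ^+ 2 * C ^+ 2 * (4%:R * (b ^ 2)%:R * d) = L2 * d by rewrite /L2 !mulrA.
have : 3%:R * beta = b%:R * theta ^+ 2 by rewrite /beta; field.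
lra.
Qed.

Lemma packable_lim (R : archiRealFieldType) (b : nat) (g : R) :
  (0 < b)%N -> 0 < g -> exists2 g', g' <= g & packable b g'.
Proof.
move=> b0 g0.
have b1 : 1 <= b%:R :> R by rewrite ler1n.
pose theta := Num.min 4%:R^-1 (Num.min 1 g / (4%:R * b%:R)) : R.
have b4 : 0 < 4%:R * b%:R :> R by lra.
have t0 : 0 < theta by rewrite !lt_min invr_gt0 ltr0n divr_gt0 // lt_min ltr01.
have t4 : theta <= 4%:R^-1 by rewrite ge_min lexx.
have tg : theta * (4%:R * b%:R) <= Num.min 1 g.
  by rewrite -ler_pdivlMr // ge_min lexx orbT.
have tg1 : theta * (4%:R * b%:R) <= 1 by apply: (le_trans tg); rewrite ge_min lexx.
have {}tg : theta * (4%:R * b%:R) <= g by apply: (le_trans tg); rewrite ge_min lexx orbT.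
pose c := 2%:R * b%:R * theta.
have c01 : 0 <= c <= 1 by apply/andP; split; rewrite /c ?mulr_ge0 //; lra.
have packj j : packable b (c + (1 - c) * (1 - theta) ^+ j).
  elim: j => [|j IHj]; first by rewrite expr0 mulr1 addrC subrK; apply: packable1.
  have a01 : 0 <= (1 - theta) ^+ j <= 1 by rewrite exprn_ge0 ?exprn_ile1 //; lra.
  have := @packable_step R b _ theta b0 _ _ IHj.
  rewrite (_ : _ + 2%:R * b%:R * theta ^+ 2 = c + (1 - c) * (1 - theta) ^+ j.+1).
    apply; last by rewrite t0.
    case/andP: c01 => c0 c1; case/andP: a01 => a0 a1.
    have : (1 - c) * (1 - theta) ^+ j <= 1 - c by rewrite ler_piMr // subr_ge0.
    have : 0 <= (1 - c) * (1 - theta) ^+ j by rewrite mulr_ge0 // subr_ge0.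
    by move=> u v; apply/andP; split; lra.
  by rewrite [(1 - theta) ^+ j.+1]exprS /c; ring.
have [j jP] : exists j, (1 - theta) ^+ j <= g / 2%:R.
  pose j := Num.bound (2%:R / (g * theta)); exists j.
  have gt0 : 0 < g * theta by rewrite mulr_gt0.
  have jb : 2%:R / (g * theta) < j%:R.
    by apply: archi_boundP; rewrite divr_ge0 // ltW.
  have : (1 - theta) ^+ j * (1 + j%:R * theta) <= 1.
    elim: (j) => [|i IHi]; first by rewrite expr0 mul0r addr0 mulr1.
    apply: le_trans IHi; rewrite exprS -mulrA mulrCA ler_wpM2l ?exprn_ge0 //; first lra.
    rewrite -natr1 -subr_ge0.
    have -> : 1 + i%:R * theta - (1 - theta) * (1 + (i%:R + 1) * theta)
      = theta ^+ 2 * (i%:R + 1) by ring.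
    by rewrite mulr_ge0 ?sqr_ge0 // addr_ge0.
  move: jb; rewrite ltr_pdivrMr // => jb H.
  have a0 : 0 <= (1 - theta) ^+ j by rewrite exprn_ge0 //; lra.
  have : (1 - theta) ^+ j * (2%:R / g) <= 1.
    apply: le_trans H; rewrite ler_wpM2l // ler_pdivrMr //; lra.
  by rewrite mulrA ler_pdivrMr // mul1r -ler_pdivlMr.
exists (c + (1 - c) * (1 - theta) ^+ j); last exact: packj.
have : (1 - c) * (1 - theta) ^+ j <= (1 - theta) ^+ j.
  rewrite ler_piMl ?exprn_ge0 //; case/andP: c01; lra.
rewrite /c; lra.
Qed.

(** * Induced packings *)

Section Counting.
Local Open Scope nat_scope.

Lemma exists_perm_imset (T : finType) (u v : {set T}) :
  #|u| = #|v| -> exists s : {perm T}, s @: u = v.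
Proof.
move=> cuv; pose l (w : {set T}) := enum w ++ enum (~: w).
have lE w x : x \in l w by rewrite mem_cat !mem_enum inE orbN.
have ul w : uniq (l w).
  rewrite cat_uniq !enum_uniq andbT /=; apply/hasPn => x.
  by rewrite !mem_enum inE.
have sl w : size (l w) = #|T| by rewrite size_cat -!cardE cardsC.
pose h x := nth x (l v) (index x (l u)).
have lt_idx x : index x (l u) < size (l v) by rewrite sl -(sl u) index_mem.
have h_inj : injective h.
  move=> x y; rewrite /h (set_nth_default x y) //.
  move/eqP; rewrite nth_uniq // => /eqP.
  by move/(congr1 (nth x (l u))); rewrite !nth_index.
exists (perm h_inj); apply/eqP; rewrite eqEcard card_imset ?cuv ?leqnn ?andbT; last exact: perm_inj.
apply/subsetP => _ /imsetP[x xu ->]; rewrite permE /h /l.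
have ix : index x (enum u ++ enum (~: u)) < size (enum v).
  by rewrite index_cat mem_enum xu -cardE -cuv cardE index_mem mem_enum.
by rewrite nth_cat ix -mem_enum mem_nth.
Qed.

Lemma expn_le_ffact n k : 2 * k <= n -> n ^ k <= n ^_ k * 2 ^ k.
Proof.
move=> kn; suff H j : j <= k -> n ^ j <= n ^_ j * 2 ^ j by apply: H.
elim: j => // j IHj jk; rewrite ffactnSr !expnSr mulnACA leq_mul ?IHj //.
  exact: ltnW.
lia.
Qed.

Lemma card_overlap (n k t : nat) (Y : {set 'I_n}) : #|Y| <= 2 * k ->
  #|[set f : {ffun 'I_k -> 'I_n} | t < #|f @^-1: Y|]| * n
  <= 2 ^ k * (2 * k) ^ k * n ^ (k - t).
Proof.
move=> cY.
pose fam (X : {set 'I_k}) := fun i : 'I_k => [pred y : 'I_n | (i \in X) ==> (y \in Y)].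
have sub : [set f : {ffun 'I_k -> 'I_n} | t < #|f @^-1: Y|] \subset
    \bigcup_(X in [set X : {set 'I_k} | t < #|X|]) [set f in family (fam X)].
  apply/subsetP => f; rewrite inE => tf; apply/bigcupP; exists (f @^-1: Y); rewrite inE //.
  by apply/familyP => i; rewrite !inE implybb.
apply: (leq_trans (leq_mul (leq_trans (subset_leq_card sub) (card_bigcup_le _ _)) (leqnn n))).
rewrite big_distrl /=.
apply: (@leq_trans (\sum_(X in [set X : {set 'I_k} | t < #|X|]) (2 * k) ^ k * n ^ (k - t))).
  apply: leq_sum => X; rewrite inE => tX.
  have Xk : #|X| <= k by rewrite -[leqRHS]card_ord max_card.
  have -> : #|[set f in family (fam X)]| = #|Y| ^ #|X| * n ^ (k - #|X|).
    rewrite cardsE card_family foldrE big_map big_enum /=.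
    rewrite (bigID (mem X)) /= -prod_nat_const.
    have -> : k - #|X| = #|~: X| by have := cardsC X; rewrite card_ord; lia.
    rewrite -prod_nat_const; congr (_ * _).
      apply: eq_bigr => i iX; apply: eq_card => y; change ((i \in X) ==> (y \in Y) = (y \in Y)).
      by rewrite (iX : i \in X).
    apply: eq_big => i; first by rewrite inE.
    move=> /negbTE iX; rewrite -[RHS]card_ord; apply: eq_card => y.
    by change ((i \in X) ==> (y \in Y) = true); rewrite iX.
  rewrite -mulnA leq_mul //.
    apply: (@leq_trans ((2 * k) ^ #|X|)); first by rewrite leq_exp2r // (leq_ltn_trans _ tX).
    by rewrite leq_pexp2l // muln_gt0 /= (leq_trans _ Xk) // (leq_ltn_trans _ tX).
  rewrite -expnSr; case: (n) => [|n']; first by rewrite exp0n.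
  by rewrite leq_pexp2l // ltn_sub2l // (leq_trans tX).
rewrite sum_nat_const mulnA leq_mul // leq_mul //.
by rewrite -[k in 2 ^ k]card_ord -cardsT -card_powerset subset_leq_card // powersetT subsetT.
Qed.

Lemma bin_le_expn n t : 'C(n, t) <= n ^ t.
Proof.
apply: (@leq_trans (n ^_ t)); first by rewrite -bin_ffact leq_pmulr // fact_gt0.
by elim: t => // t IHt; rewrite ffactnSr expnSr leq_mul // leq_subr.
Qed.

Section Copies.
Variables (n k t : nat) (T : {set {set 'I_k}}).
Hypothesis T_t : forall A, A \in T -> #|A| = t.
Hypothesis T_gt0 : 0 < #|T|.
Hypothesis t_lt_k : t < k.
Hypothesis n_ge : 2 * k <= n.

Local Notation E := {ffun 'I_k -> 'I_n}.

Definition blue (f : E) : {set {set 'I_n}} := [set f @: (A : {set 'I_k}) | A in T].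
Definition red (f : E) : {set {set 'I_n}} :=
  [set f @: (A : {set 'I_k}) | A in [set A : {set 'I_k} | #|A| == t] :\: T].
Definition image_set (f : E) : {set 'I_n} := f @: [set: 'I_k].
Definition conflict (f g : E) : bool :=
  ~~ [disjoint blue f & blue g] || (t < #|image_set f :&: image_set g|).
Definition copies : {set E} := [set f : E | injectiveb f].

Lemma copiesP (f : E) : reflect (injective f) (f \in copies).
Proof. by rewrite inE; apply: injectiveP. Qed.

Lemma card_blue f : f \in copies -> #|blue f| = #|T|.
Proof. by move/copiesP => fi; rewrite card_imset //; apply: imset_inj. Qed.

Lemma card_red f : f \in copies -> #|red f| = 'C(k, t) - #|T|.
Proof.
move/copiesP => fi; rewrite card_imset; last exact: imset_inj.
rewrite cardsD (setIidPr _) ?card_draws ?card_ord //.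
by apply/subsetP => A /T_t; rewrite inE => ->.
Qed.

Lemma blue_red_disjoint f : f \in copies -> [disjoint blue f & red f].
Proof.
move/copiesP => fi; apply/pred0Pn => -[_ /= /andP[/imsetP[A AT ->] /imsetP[A' + /eqP]]].
rewrite inE => /andP[A'T _]; rewrite (inj_eq (imset_inj fi)) => /eqP AA'.
by rewrite -AA' AT in A'T.
Qed.

Lemma blue_redP (f : E) u :
  reflect (exists2 A : {set 'I_k}, #|A| = t & u = f @: A) (u \in blue f :|: red f).
Proof.
apply: (iffP idP) => [|[A At ->]].
  rewrite inE => /orP[] /imsetP[A].
    by move/T_t => At ->; exists A.
  by rewrite !inE => /andP[_ /eqP At] ->; exists A.
rewrite inE; case: (boolP (A \in T)) => AT.
  by rewrite (imset_f (fun B : {set 'I_k} => f @: B) AT).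
by apply/orP; right; apply/imsetP; exists A; rewrite // !inE AT At eqxx.
Qed.

Lemma card_blue_red f u : f \in copies -> u \in blue f :|: red f -> #|u| = t.
Proof. by move/copiesP => fi /blue_redP[A At ->]; rewrite card_imset. Qed.

Lemma blue_red_sub f u : u \in blue f :|: red f -> u \subset image_set f.
Proof. by case/blue_redP => A _ ->; rewrite imsetS // subsetT. Qed.

Lemma star_copies_le (u v : {set 'I_n}) : #|u| = #|v| ->
  #|star blue copies u| <= #|star blue copies v|.
Proof.
case/exists_perm_imset => s suv; pose h (f : E) : E := [ffun i => s (f i)].
have h_inj : injective h.
  move=> f g /ffunP fg; apply/ffunP => i; have := fg i; rewrite !ffunE.
  exact: perm_inj.
rewrite -(card_imset _ h_inj); apply/subset_leq_card/subsetP => _ /imsetP[f fu ->].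
move: fu; rewrite !inE => /andP[/injectiveP fi /imsetP[A AT uA]].
apply/andP; split.
  by apply/injectiveP => i j; rewrite !ffunE => /perm_inj /fi.
apply/imsetP; exists A => //; rewrite -suv uA -imset_comp.
by apply: eq_imset => i; rewrite /= ffunE.
Qed.

Definition degree : nat := #|T| * n ^_ k %/ 'C(n, t).

Lemma card_copies : #|copies| = n ^_ k.
Proof. by rewrite card_inj_ffuns !card_ord. Qed.

Lemma star_copies_mul (v : {set 'I_n}) : #|v| = t ->
  #|star blue copies v| * 'C(n, t) = #|T| * n ^_ k.
Proof.
move=> vt.
have blueV e : e \in copies -> blue e \subset [set v : {set 'I_n} | #|v| == t].
  move=> eF; apply/subsetP => u ue; rewrite inE (card_blue_red eF) //.
  by rewrite inE ue.
have := @sum_star rat _ _ blue (fun _ _ => 1%R) _ _ blueV.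
rewrite (eq_bigr (fun _ => #|star blue copies v|%:R)%R); last first.
  move=> u; rewrite inE => /eqP ut; rewrite sumr_cards mulr1; congr (_%:R)%R.
  by apply/eqP; rewrite eqn_leq !star_copies_le // ut vt.
rewrite [RHS](eq_bigr (fun _ => #|T|%:R)%R); last first.
  by move=> e eF; rewrite sumr_cards mulr1 card_blue.
rewrite !sumr_cards card_draws card_ord card_copies -!natrM => /eqP.
by rewrite Num.Theory.eqr_nat mulnC => /eqP ->; rewrite mulnC.
Qed.

Lemma star_copies (v : {set 'I_n}) : #|v| = t -> #|star blue copies v| = degree.
Proof.
move=> vt; rewrite /degree -(star_copies_mul vt) mulnK // bin_gt0; lia.
Qed.

Lemma degree_ge : n ^ (k - t) <= degree * 2 ^ k.
Proof.
have n0 : 0 < n by lia.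
have : 0 < #|[set v : {set 'I_n} | #|v| == t]|.
  by rewrite card_draws card_ord bin_gt0; lia.
rewrite card_gt0 => /set0Pn[v]; rewrite inE => /eqP vt.
have := star_copies_mul vt; rewrite star_copies // => degC.
rewrite -(@leq_pmul2r (n ^ t)) ?expn_gt0 ?n0 // -expnD subnK; last exact: ltnW.
apply: leq_trans (expn_le_ffact n_ge) _.
apply: (@leq_trans (degree * 'C(n, t) * 2 ^ k)).
  by rewrite degC leq_mul2r leq_pmull ?orbT.
by rewrite mulnAC leq_mul // bin_le_expn.
Qed.

Definition overlap_const : nat := 2 ^ k * (2 * k) ^ k * 2 ^ k.

Lemma overlap_le (Y : {set 'I_n}) (F : {set E}) : #|Y| <= 2 * k ->
    (forall f, f \in F -> t < #|f @^-1: Y|) ->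
  #|F| * n <= overlap_const * degree.
Proof.
move=> cY FY; apply: (@leq_trans (2 ^ k * (2 * k) ^ k * n ^ (k - t))).
  apply: leq_trans (card_overlap t cY); rewrite leq_mul2r.
  apply/orP; right; apply/subset_leq_card/subsetP => f /FY.
  by rewrite inE.
by rewrite /overlap_const -[X in _ <= X]mulnA leq_mul // mulnC degree_ge.
Qed.

Lemma overlap_two (f : E) (u v Y : {set 'I_n}) : f \in copies -> u != v ->
    u \in blue f :|: red f -> v \in blue f :|: red f -> u \subset Y -> v \subset Y ->
  t < #|f @^-1: Y|.
Proof.
move=> /copiesP fi uv /blue_redP[A At uA] /blue_redP[A' At' vA'] uY vY.
have AA' : A' \proper A :|: A'.
  rewrite properE subsetUr /=; apply: contra uv => /subUsetP[AA' _].
  by rewrite uA vA' (_ : A = A') //; apply/eqP; rewrite eqEcard AA' At At' /=.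
rewrite -At'; apply: leq_trans (proper_card AA') _; apply: subset_leq_card.
rewrite subUset -!sub_imset_pre -uA -vA' uY //.
Qed.

Lemma in_star_copies (f : E) v :
  (f \in star blue copies v) = (f \in copies) && (v \in blue f).
Proof. by rewrite [LHS]inE. Qed.

Lemma codegree_copies (u v : {set 'I_n}) : u != v ->
  #|star blue copies u :&: star blue copies v| * n <= overlap_const * degree.
Proof.
move=> uv; case: (set_0Vmem (star blue copies u :&: star blue copies v)) => [->|[f]].
  by rewrite cards0.
rewrite in_setI !in_star_copies => /andP[/andP[fC fu] /andP[_ fv]].
have cu : #|u| = t by apply: (card_blue_red fC); rewrite inE fu.
have cv : #|v| = t by apply: (card_blue_red fC); rewrite inE fv.
apply: (@overlap_le (u :|: v)).
  by rewrite cardsU cu cv; lia.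
move=> g; rewrite in_setI !in_star_copies => /andP[/andP[gC gu] /andP[_ gv]].
apply: (@overlap_two g u v) => //; rewrite ?inE ?gu ?gv //.
- exact: subsetUl.
- exact: subsetUr.
Qed.

Lemma card_image_set (f : E) : #|image_set f| <= k.
Proof. by rewrite (leq_trans (leq_imset_card _ _)) // cardsT card_ord. Qed.

Lemma conflict_copies f : f \in copies ->
  #|[set g in nbr conflict copies f | [disjoint blue f & blue g]]| * n
  <= overlap_const * degree.
Proof.
move=> fC; apply: (@overlap_le (image_set f)).
  by have := card_image_set f; lia.
move=> g; rewrite !inE /conflict => /andP[/andP[gC +] dj]; rewrite dj /= => /leq_trans; apply.
apply: leq_trans (leq_imset_card g _); apply/subset_leq_card/subsetP => x.
rewrite inE => /andP[xf /imsetP[i _ xi]]; apply/imsetP; exists i => //.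
by rewrite inE -xi.
Qed.

Lemma bad_pairs_copies f v : f \in star blue copies v ->
  #|[set g in star blue copies v
      | (blue f :|: red f) :&: (blue g :|: red g) != [set v]]| * n
  <= overlap_const * degree.
Proof.
rewrite in_star_copies => /andP[fC fv]; apply: (@overlap_le (image_set f)).
  by have := card_image_set f; lia.
move=> g; rewrite [_ \in _]inE in_star_copies => /andP[/andP[gC gv] cap].
have fvr : v \in blue f :|: red f by rewrite inE fv.
have gvr : v \in blue g :|: red g by rewrite inE gv.
have /subsetPn[u] : ~~ ((blue f :|: red f) :&: (blue g :|: red g) \subset [set v]).
  apply: contra cap => sub; rewrite eqEsubset sub /=.
  by rewrite sub1set in_setI fvr.
rewrite in_setI in_set1 => /andP[uf ug] uv.
by apply: (overlap_two gC uv ug gvr); apply: blue_red_sub.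
Qed.

Local Open Scope ring_scope.

Section Trash.
Variables (R : archiRealFieldType) (eps : R).
Hypothesis eps01 : 0 < eps < 1.

Definition valid (S : {set {set 'I_n}}) (f : E) : bool :=
  (red f \subset S) && [disjoint blue f & S].
Definition valid_copies S : {set E} := [set f in copies | valid S f].
Definition clean_sets (S : {set {set 'I_n}}) : {set {set 'I_n}} :=
  [set v : {set 'I_n} | (#|v| == t) && (v \notin S)].
Definition valid_prob : R := eps ^+ ('C(k, t) - #|T|) * (1 - eps) ^+ #|T|.-1.

Let m := ('C(k, t) - #|T|)%N.
Let b := #|T|.
Let beta := valid_prob.
Let D : R := beta * degree%:R.

Let beta_gt0 : 0 < beta.
Proof.
by case/andP: eps01 => e0 e1; rewrite mulr_gt0 // exprn_gt0 // subr_gt0.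
Qed.

Let n_gt0 : (0 : R) < n%:R.
Proof. by rewrite ltr0n; lia. Qed.

Let degree_gt0 : (0 : R) < degree%:R.
Proof.
rewrite ltr0n lt0n; apply/negP => /eqP d0; have := degree_ge.
by rewrite d0 mul0n leqn0 expn_eq0; lia.
Qed.

Let D_gt0 : 0 < D. Proof. exact: mulr_gt0. Qed.

Let overlap_real (a : nat) : (a * n <= overlap_const * degree)%N ->
  a%:R <= overlap_const%:R / n%:R * degree%:R :> R.
Proof.
by move=> H; rewrite mulrAC ler_pdivlMr // -!natrM ler_nat.
Qed.

Lemma valid_near_regular S d : overlap_const%:R / n%:R <= d * beta ->
  near_regular blue conflict b (clean_sets S) (valid_copies S) beta^-1 D d.
Proof.
move=> nd.
have Fsub : valid_copies S \subset copies.
  by apply/subsetP => f; rewrite inE => /andP[].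
have starS v : star blue (valid_copies S) v \subset star blue copies v.
  apply/subsetP => f; rewrite inE => /andP[fF fv].
  by rewrite in_star_copies fv (subsetP Fsub).
have small a : (a * n <= overlap_const * degree)%N -> a%:R <= d * D.
  move/overlap_real => /le_trans -> //.
  by rewrite /D mulrA ler_wpM2r.
split.
- move=> f fF; have fC := subsetP Fsub f fF; split; first exact: card_blue.
  apply/subsetP => v fv; rewrite inE (card_blue_red fC) ?inE ?fv // eqxx /=.
  by move: fF; rewrite inE => /andP[_ /andP[_ /disjointFr ->]].
- move=> v; rewrite /D mulKf ?gt_eqF //.
  apply: (le_trans (y := #|star blue copies v|%:R)); first by rewrite ler_nat subset_leq_card.
  have [-> //|[f]] := set_0Vmem (star blue copies v); first by rewrite cards0.
  rewrite in_star_copies => /andP[fC fv]; rewrite star_copies //.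
  by rewrite (card_blue_red fC) // inE fv.
- move=> u v uv; apply: small; apply: leq_trans (codegree_copies uv).
  by rewrite leq_mul2r subset_leq_card ?orbT // setISS.
- move=> f fF; have fC := subsetP Fsub f fF.
  apply: small; apply: leq_trans (conflict_copies fC).
  rewrite leq_mul2r; apply/orP; right; apply/subset_leq_card/subsetP => g.
  rewrite [_ \in _]inE => /andP[+ dj]; rewrite [_ \in _]inE => /andP[gF fg].
  by rewrite inE dj andbT inE fg (subsetP Fsub).
Qed.

Lemma expect_valid f : f \in copies ->
  expect eps (fun S => (valid S f)%:R) = (1 - eps) * beta.
Proof.
move=> fC; rewrite /valid expect_in_out; last by rewrite disjoint_sym blue_red_disjoint.
rewrite card_red // card_blue // /beta /valid_prob mulrCA; congr (_ * _).
by rewrite -exprS prednK.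
Qed.

Lemma expect_valid_pair f g v :
    f \in star blue copies v -> g \in star blue copies v ->
    (blue f :|: red f) :&: (blue g :|: red g) = [set v] ->
  expect eps (fun S => (valid S f && valid S g)%:R) = (1 - eps) * beta ^+ 2.
Proof.
rewrite !in_star_copies => /andP[fC fv] /andP[gC gv] cap.
have vfr : v \notin red f by rewrite (disjointFr (blue_red_disjoint fC)).
have vgr : v \notin red g by rewrite (disjointFr (blue_red_disjoint gC)).
have capP u : u \in blue f :|: red f -> u \in blue g :|: red g -> u = v.
  by move=> uf ug; apply/set1P; rewrite -cap inE uf ug.
have -> : expect eps (fun S => (valid S f && valid S g)%:R)
    = expect eps (fun S => ((red f :|: red g \subset S)
        && [disjoint blue f :|: blue g & S])%:R).
  apply: eq_bigr => S _; congr (_ * (nat_of_bool _)%:R); rewrite /valid subUset.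
  by rewrite -!setI_eq0 setIUl setU_eq0 andbACA.
rewrite expect_in_out; last first.
  rewrite -setI_eq0; apply/set0Pn => -[u]; rewrite in_setI !in_setU.
  case/andP => /orP[uf|ug] /orP[uf'|ug'].
  - by rewrite (disjointFr (blue_red_disjoint fC) uf') in uf.
  - by move: vfr; rewrite -(capP u) ?uf // inE ?uf ?ug' ?orbT.
  - by move: vgr; rewrite -(capP u) ?ug // inE ?ug ?uf' ?orbT.
  - by rewrite (disjointFr (blue_red_disjoint gC) ug') in ug.
have -> : #|red f :|: red g| = (m + m)%N.
  rewrite cardsU !card_red // -/m (_ : red f :&: red g = set0) ?cards0 ?subn0 //.
  apply/setP => u; rewrite in_setI [RHS]inE; apply/negbTE/negP => /andP[uf ug].
  by move: vfr; rewrite -(capP u) ?uf // inE ?uf ?ug orbT.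
have -> : #|blue f :|: blue g| = (b + b.-1)%N.
  rewrite cardsU !card_blue // -/b (_ : blue f :&: blue g = [set v]).
    by rewrite cards1 -subn1 addnBA.
  apply/setP => u; rewrite in_setI in_set1; apply/andP/eqP => [[uf ug]|-> //].
  by apply: capP; rewrite inE ?uf ?ug.
have -> : (b + b.-1 = (b.-1 + b.-1).+1)%N by rewrite -addSn prednK.
rewrite /beta /valid_prob -/m -/b exprS !exprD.
by move: (eps ^+ m) ((1 - eps) ^+ b.-1) => x y; ring.
Qed.

Lemma expect_trash_irregularity (v : {set 'I_n}) : #|v| = t ->
  expect eps (fun S => (v \in clean_sets S)%:R
      * (#|star blue (valid_copies S) v|%:R / D - 1) ^+ 2)
  <= overlap_const%:R / (beta ^+ 2 * n%:R).
Proof.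
move=> vt; set X := star blue copies v.
have cX : #|X| = degree by apply: star_copies.
case/andP: eps01 => e0 e1.
have starE S : #|star blue (valid_copies S) v|%:R = \sum_(f in X) (valid S f)%:R :> R.
  rewrite -natr_cards_sum; congr (_%:R); apply: eq_card => f.
  by rewrite [RHS]inE in_star_copies [LHS]inE [f \in valid_copies S]inE andbAC.
have eX S : (v \in clean_sets S)%:R * (#|star blue (valid_copies S) v|%:R / D - 1) ^+ 2 =
    D ^- 2 * (\sum_(f in X) \sum_(g in X) (valid S f && valid S g)%:R)
    - 2%:R / D * (\sum_(f in X) (valid S f)%:R) + [disjoint [set v] & S]%:R :> R.
  have -> : \sum_(f in X) \sum_(g in X) (valid S f && valid S g)%:R
      = #|star blue (valid_copies S) v|%:R ^+ 2 :> R.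
    rewrite starE expr2 mulr_suml; apply: eq_bigr => f _; rewrite mulr_sumr.
    by apply: eq_bigr => g _; rewrite -natrM mulnb.
  rewrite -starE inE vt eqxx disjoints_subset sub1set inE /=.
  case: (boolP (v \in S)) => vS /=; last by field; rewrite gt_eqF.
  rewrite starE big1 => [|f]; first by rewrite /= !expr2; ring.
  rewrite in_star_copies => /andP[_ fv]; case: (boolP (valid S f)) => // /andP[_ fS].
  by rewrite (disjointFr fS) in vS.
have -> : expect eps (fun S => (v \in clean_sets S)%:R
      * (#|star blue (valid_copies S) v|%:R / D - 1) ^+ 2)
   = D ^- 2 * (\sum_(f in X) \sum_(g in X) expect eps (fun S => (valid S f && valid S g)%:R))
    - 2%:R / D * (\sum_(f in X) expect eps (fun S => (valid S f)%:R)) + (1 - eps).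
  rewrite /expect; under eq_bigr do rewrite eX.
  rewrite -/(expect eps _) expectD expectB !expectZ expect_disjoint cards1 expr1 !expect_sum.
  congr (_ * _ - _ + _); apply: eq_bigr => e _.
  by rewrite expect_sum.
have -> : \sum_(f in X) expect eps (fun S => (valid S f)%:R)
    = degree%:R * ((1 - eps) * beta).
  rewrite -cX -sumr_cards; apply: eq_bigr => f; rewrite in_star_copies => /andP[fC _].
  exact: expect_valid.
have pairs : \sum_(f in X) \sum_(g in X) expect eps (fun S => (valid S f && valid S g)%:R)
  <= degree%:R * (degree%:R * ((1 - eps) * beta ^+ 2)
        + overlap_const%:R / n%:R * degree%:R).
  rewrite -{1}cX -sumr_cards; apply: ler_sum => f fX.
  apply: le_trans (lerD (lexx _) (overlap_real (bad_pairs_copies fX))).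
  rewrite natr_cards_sum -{1}cX -sumr_cards -big_split /=; apply: ler_sum => g gX.
  case: eqVneq => [cap|_] /=; first by rewrite addr0 (expect_valid_pair fX gX cap).
  have e01 : 0 <= eps <= 1 by rewrite !ltW.
  apply: (le_trans (y := 1)).
    rewrite -[leRHS](bernoulli_sum1 {set 'I_n} eps).
    apply: ler_sum => S _; rewrite ler_piMr ?bernoulli_ge0 //.
    by rewrite lern1 leq_b1.
  by rewrite lerDr mulr_ge0 ?sqr_ge0 // subr_ge0 ltW.
have D2 : 0 <= D ^- 2 by rewrite invr_ge0 sqr_ge0.
have := ler_wpM2l D2 pairs.
have -> : D ^- 2 * (degree%:R * (degree%:R * ((1 - eps) * beta ^+ 2)
        + overlap_const%:R / n%:R * degree%:R))
   = (1 - eps) + overlap_const%:R / (beta ^+ 2 * n%:R).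
  by rewrite /D; field; rewrite ?gt_eqF.
have -> : 2%:R / D * (degree%:R * ((1 - eps) * beta)) = 2%:R * (1 - eps).
  by rewrite /D; field; rewrite ?gt_eqF.
lra.
Qed.

End Trash.

End Copies.
End Counting.

Lemma conflict_sym n k t (T : {set {set 'I_k}}) : symmetric (@conflict n k t T).
Proof. by move=> f g; rewrite /conflict disjoint_sym setIC. Qed.

Lemma valid_not_sub n k t (T : {set {set 'I_k}}) S (f g : {ffun 'I_k -> 'I_n}) A :
    (forall A, A \in T -> #|A| = t) ->
    f \in valid_copies t T S -> g \in valid_copies t T S ->
    [disjoint blue T f & blue T g] -> A \in T ->
  ~~ (f @: A \subset image_set g).
Proof.
move=> T_t; rewrite !inE => /andP[/injectiveP fi /andP[_ fS]].
move=> /andP[/injectiveP gi /andP[gS _]] dj AT; apply/negP => sub.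
have fA : f @: A \in blue T f by rewrite (imset_f (fun B : {set 'I_k} => f @: B)).
pose A' := g @^-1: (f @: A).
have gA' : g @: A' = f @: A.
  apply/setP => y; apply/imsetP/idP => [[i]|yA]; first by rewrite inE => ? ->.
  have /imsetP[i _ yi] := subsetP sub y yA; exists i => //.
  by rewrite inE -yi.
have A't : #|A'| = t by rewrite -(card_imset _ gi) gA' card_imset // T_t.
have : f @: A \in blue T g :|: red t T g by apply/blue_redP => //; exists A'.
rewrite inE (disjointFr dj fA) /= => /(subsetP gS) fAS.
by rewrite (disjointFr fS fA) in fAS.
Qed.

Lemma induced_packing (R : archiRealFieldType) (k t : nat) (T : {set {set 'I_k}}) (e : R) :
    (forall A, A \in T -> #|A| = t) -> (0 < #|T|)%N -> (t < k)%N -> 0 < e < 1 ->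
  exists n0, forall n, (n0 <= n)%N -> exists M : {set {ffun 'I_k -> 'I_n}},
    [/\ forall f : {ffun 'I_k -> 'I_n}, f \in M -> injective f,
        {in M &, forall f g : {ffun 'I_k -> 'I_n},
          f != g -> (#|image_set f :&: image_set g| <= t)%N},
        {in M &, forall f g : {ffun 'I_k -> 'I_n},
          f != g -> forall A : {set 'I_k}, A \in T -> ~~ (f @: A \subset image_set g)} &
        (1 - e) * 'C(n, t)%:R <= #|T|%:R * #|M|%:R].
Proof.
move=> T_t T0 tk /andP[e0 e1].
have e3 : 0 < e / 3%:R by rewrite divr_gt0.
have [g ge packg] := packable_lim T0 e3.
pose eps := e / 3%:R.
have eps01 : 0 < eps < 1 by rewrite e3 /eps; lra.
pose beta : R := valid_prob t T eps.
have beta0 : 0 < beta.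
  by case/andP: (eps01) => ? ?; rewrite mulr_gt0 // exprn_gt0 // subr_gt0.
have beta1 : beta <= 1.
  case/andP: (eps01) => ? ?; rewrite -[1]mulr1 ler_pM ?exprn_ge0 ?exprn_ile1 //; lra.
have C1 : 1 <= beta^-1 by rewrite invf_ge1.
have [K [d [K0 d0 pack]]] := packg _ C1.
have K1 : 0 < K + 1 by lra.
pose tau := e / (6%:R * (K + 1)).
have tau0 : 0 < tau by rewrite divr_gt0 // mulr_gt0.
pose Lam : R := (overlap_const k)%:R.
have Lam0 : 0 <= Lam by [].
pose X1 := Lam / (d * beta); pose X2 := 2%:R ^+ k / (d * beta).
pose X3 := Lam * (K / tau) / beta ^+ 2 * (6%:R / e).
have db : 0 < d * beta by rewrite mulr_gt0.
have X10 : 0 <= X1 by rewrite divr_ge0 // ltW.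
have X20 : 0 <= X2 by rewrite divr_ge0 ?exprn_ge0 // ltW.
have X30 : 0 <= X3.
  by rewrite !mulr_ge0 ?invr_ge0 ?sqr_ge0 // ltW.
exists (2 * k + Num.bound (X1 + X2 + X3))%N => n nn.
have n_ge : (2 * k <= n)%N := leq_trans (leq_addr _ _) nn.
have nX : X1 + X2 + X3 <= n%:R.
  apply: (@le_trans _ _ (Num.bound (X1 + X2 + X3))%:R).
    by rewrite ltW // archi_boundP // !addr_ge0.
  by rewrite ler_nat (leq_trans (leq_addl _ _) nn).
have n_gt0 : (0 < n)%N.
  by rewrite (leq_trans _ n_ge) // muln_gt0 (leq_ltn_trans _ tk).
have n0 : 0 < n%:R :> R by rewrite ltr0n.
have Ln : Lam / n%:R <= d * beta.
  rewrite ler_pdivrMr // mulrC -ler_pdivrMr // -/X1; lra.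
pose D : R := beta * (degree n t T)%:R.
have dD : 1 <= d * D.
  have := degree_ge T_t T0 tk n_ge; rewrite -(ler_nat R) natrM !natrX => deg.
  rewrite /D mulrA -ler_pdivrMl // mulr1.
  rewrite -(ler_pM2r (_ : 0 < 2%:R ^+ k :> R)) ?exprn_gt0 //.
  apply: le_trans deg; rewrite mulrC -/X2; apply: (@le_trans _ _ n%:R); first lra.
  by rewrite -[leLHS]expr1 -!natrX ler_nat leq_pexp2l // subn_gt0.
pose W S : {set {set 'I_n}} := clean_sets t S.
pose F S : {set {ffun 'I_k -> 'I_n}} := valid_copies t T S.
pose V0 := [set v : {set 'I_n} | #|v| == t].
have cV0 : #|V0| = 'C(n, t) by rewrite card_draws card_ord.
pose Y (v : {set 'I_n}) S := (v \in W S)%:R * (#|star (@blue n k T) (F S) v|%:R / D - 1) ^+ 2.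
pose val (S : {set {set 'I_n}}) := (1 - g) * (\sum_(v in V0) [disjoint [set v] & S]%:R)
  - K * (\sum_(v in V0) (tau + tau^-1 * Y v S)).
have e01 : 0 <= eps <= 1 by case/andP: eps01 => ? ?; rewrite !ltW.
have [S valS] := expect_attained e01 val.
have near := valid_near_regular T_t T0 tk n_ge eps01 S Ln.
have [M [MF indM cM]] := pack _ _ _ _ _ _ _ (@conflict_sym n k t T)
  (fun f g => (fun H => introT orP (or_introl H))) near dD.
have FC f : f \in M -> f \in copies n k.
  by move=> /(subsetP MF); rewrite inE => /andP[].
exists M; split.
- by move=> f /FC; rewrite inE => /injectiveP.
- move=> f h fM hM /(indM f h fM hM); by rewrite negb_or -leqNgt => /andP[].
- move=> f h fM hM /(indM f h fM hM); rewrite negb_or negbK => /andP[dj _] A AT.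
  exact: (valid_not_sub T_t (subsetP MF f fM) (subsetP MF h hM) dj AT).
apply: le_trans cM; apply: (@le_trans _ _ (val S)); last first.
  rewrite /val lerD //.
    rewrite ler_wpM2l ?subr_ge0 //; first lra.
    rewrite -natr_cards_sum ler_nat; apply/subset_leq_card/subsetP => v.
    by rewrite !inE disjoints_subset sub1set inE.
  rewrite lerN2 ler_wpM2l //.
  apply: irregularity_le => //; apply/subsetP => v.
  by rewrite !inE => /andP[].
apply: le_trans valS.
have -> : expect eps val = (1 - g) * (\sum_(v in V0) (1 - eps))
   - K * (\sum_(v in V0) (tau + tau^-1 * expect eps (Y v))).
  rewrite /val expectB !expectZ !expect_sum; congr (_ * _ - _ * _).
    by apply: eq_bigr => v _; rewrite expect_disjoint cards1.
  apply: eq_bigr => v _; rewrite expectD; congr (_ + _); last exact: expectZ.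
  by rewrite /expect -mulr_suml bernoulli_sum1 mul1r.
have irr : \sum_(v in V0) (tau + tau^-1 * expect eps (Y v))
   <= 'C(n, t)%:R * (tau + tau^-1 * (Lam / (beta ^+ 2 * n%:R))).
  rewrite -cV0 -sumr_cards; apply: ler_sum => v; rewrite inE => /eqP vt.
  rewrite lerD2l ler_wpM2l ?invr_ge0 ?(ltW tau0) //.
  exact: expect_trash_irregularity.
apply: (le_trans _ (lerB (lexx _) (ler_wpM2l K0 irr))).
rewrite sumr_cards cV0 mulrCA [K * _]mulrCA -mulrBr mulrC ler_wpM2l //.
have Kt : K * tau <= e / 6%:R.
  have -> : K * tau = (e / 6%:R) * (K / (K + 1)) by rewrite /tau; field; rewrite gt_eqF.
  rewrite ler_piMr //; first by rewrite divr_ge0 // ltW.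
  by rewrite ler_pdivrMr // mul1r lerDl.
have KL : K * (tau^-1 * (Lam / (beta ^+ 2 * n%:R))) <= e / 6%:R.
  have -> : K * (tau^-1 * (Lam / (beta ^+ 2 * n%:R))) = X3 / n%:R * (e / 6%:R).
    by rewrite /X3; field; rewrite !gt_eqF.
  by rewrite ler_piMl ?divr_ge0 ?(ltW e0) // ler_pdivrMr // mul1r; lra.
have : (1 - e / 3%:R) * (1 - eps) <= (1 - g) * (1 - eps).
  by rewrite ler_wpM2r //; [rewrite subr_ge0; case/andP: e01 | lra].
have : 0 <= eps ^+ 2 by exact: sqr_ge0.
rewrite [X in _ -> _ -> _ <= _ - X]mulrDr /eps; move: Kt KL.
by set u := K * tau; set w := K * _; lra.
Qed.

(** * Focal-free families *)

Section FocalFree.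
Local Open Scope nat_scope.

Lemma sum_card_disjoint (X I : finType) (M : I -> {set X}) :
  (forall i j, i != j -> [disjoint M i & M j]) -> \sum_i #|M i| <= #|X|.
Proof.
move=> dM; under eq_bigr do rewrite -sum1_card.
rewrite (exchange_big_dep predT) //= -sum1_card leq_sum // => x _.
rewrite sum1dep_card; apply/card_le1_eqP => i j; rewrite !inE => xi xj.
by apply/eqP/negPn/negP => ij; rewrite (disjointFr (dM j i ij) xj) in xi.
Qed.

Lemma extend_disjoint (X I : finType) (M : I -> {set X}) (sz : I -> nat) :
    (forall i j, i != j -> [disjoint M i & M j]) ->
    (forall i, #|M i| <= sz i) -> \sum_i sz i <= #|X| ->
  exists N : I -> {set X}, [/\ forall i, M i \subset N i, forall i, #|N i| = sz i &
    forall i j, i != j -> [disjoint N i & N j]].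
Proof.
have [d] := ubnP (\sum_i (sz i - #|M i|)).
elim: d M => // d IHd M; rewrite ltnS => dsz dM Msz szX.
case: (boolP [forall i, #|M i| == sz i]) => [/forallP Mi|/forallPn[i ni]].
  by exists M; split => // i; apply/eqP.
have lti : #|M i| < sz i by rewrite ltn_neqAle ni Msz.
have ltX : \sum_j #|M j| < \sum_j sz j.
  rewrite (bigD1 i) //= [X in _ < X](bigD1 i) //= -addSn leq_add //.
  by apply: leq_sum.
have /subsetPn[x _ xM] : ~~ ([set: X] \subset \bigcup_j M j).
  apply/negP => /subset_leq_card; rewrite cardsT leqNgt => /negP; apply.
  exact: leq_ltn_trans (card_bigcup_le _ _) (leq_trans ltX szX).
have xMj j : x \notin M j by apply: contra xM => xj; apply/bigcupP; exists j.
pose M' j := if j == i then x |: M i else M j.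
have cM' j : #|M' j| = (j == i) + #|M j|.
  by rewrite /M'; case: eqP => [->|//]; rewrite cardsU1 xMj.
have sM' j : M j \subset M' j.
  by rewrite /M'; case: eqP => [->|//]; rewrite subsetUr.
have [||||N [MN cN dN]] := IHd M'.
- apply: leq_trans dsz.
  rewrite (bigD1 i) //= [X in _ < X](bigD1 i) //= -addSn leq_add //.
    by rewrite cM' eqxx; lia.
  by apply: leq_sum => j ji; rewrite cM' (negbTE ji).
- move=> j j' jj'; rewrite /M'; case: eqP => [ji|_]; case: eqP => [j'i|_].
  + by rewrite ji j'i eqxx in jj'.
  + rewrite -setI_eq0 setIUl setU_eq0 !setI_eq0 disjoints_subset sub1set inE xMj /=.
    by rewrite -ji dM.
  + rewrite -setI_eq0 setIUr setU_eq0 !setI_eq0 disjoint_sym disjoints_subset.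
    by rewrite sub1set inE xMj /= -j'i dM.
  + exact: dM.
- by move=> j; rewrite cM'; case: eqP => [->|_]; rewrite ?lti ?Msz.
- exact: szX.
exists N; split => // j; exact: subset_trans (sM' j) (MN j).
Qed.

Lemma sum_two_sizes l c s : l <= c ->
  \sum_(i < c) (if i < l then s else s.+1) = l * s + (c - l) * s.+1.
Proof.
move=> lc; rewrite -(subnKC lc) addKn; elim: (c - l) => [|d IHd].
  rewrite addn0 (eq_bigr (fun=> s)) => [|i _]; last by rewrite ltn_ord.
  by rewrite sum_nat_const card_ord addn0.
by rewrite addnS big_ord_recr /= IHd ltnNge leq_addr /= mulSn; lia.
Qed.

Lemma focalP n r (A0 : {set 'I_n}) (A : {ffun 'I_(r - 1) -> {set 'I_n}}) :
    3 <= r -> (forall i, #|A i| = #|A0|) ->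
  reflect ((forall i, A i != A0) /\
           (forall i j, i != j -> [disjoint A0 :\: A i & A0 :\: A j])) (focal A0 A).
Proof.
move=> r3 cA.
have count x : #|[set i | x \in A i]| + #|[set i | x \notin A i]| = r - 1.
  rewrite -[RHS]card_ord -(cardsC [set i | x \in A i]); congr (_ + _).
  by apply: eq_card => i; rewrite !inE.
apply: (iffP and3P) => [[_ /forallP nA0 /forallP cnt]|[nA0 dA]].
  split=> // i j ij; apply/pred0Pn => -[x /=]; rewrite !inE => /andP[/andP[xi x0] /andP[xj _]].
  have := implyP (cnt x) x0; have := count x.
  have : 2 <= #|[set i | x \notin A i]|.
    have <- : #|[set i; j]| = 2 by rewrite cards2 ij.
    apply/subset_leq_card/subsetP => u.
    by rewrite !inE => /orP[] /eqP ->.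
  by lia.
split; last 1 first.
- apply/forallP => x; apply/implyP => x0; have := count x.
  suff : #|[set i | x \notin A i]| <= 1 by lia.
  apply/card_le1_eqP => i j; rewrite !inE => xi xj.
  apply/eqP; apply/negPn/negP => ij; have := disjointFr (dA j i ij) (_ : x \in _).
  by rewrite !inE x0 xi xj => /(_ isT).
- apply/injectiveP => i j Aij; apply/eqP; apply/negPn/negP => ij.
  have /negP := nA0 i; apply; rewrite eq_sym eqEcard cA leqnn andbT.
  by have := dA i j ij; rewrite Aij -setI_eq0 setIid -subset0 subDset setU0.
- exact/forallP.
Qed.

Lemma exists_enumeration n k (A : {set 'I_n}) : #|A| = k ->
  exists2 f : {ffun 'I_k -> 'I_n}, injective f & f @: [set: 'I_k] = A.
Proof.
move=> cA; exists [ffun i => enum_val (cast_ord (esym cA) i)].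
  by move=> i j; rewrite !ffunE => /enum_val_inj /cast_ord_inj.
apply/setP => x; apply/imsetP/idP => [[i _ ->]|xA].
  by rewrite ffunE enum_valP.
by exists (cast_ord cA (enum_rank_in xA x)); rewrite // ffunE cast_ordK enum_rankK_in.
Qed.

Lemma max_no_matching_attained k s l : 0 < l ->
  exists H : {set {set 'I_k}}, [/\ forall B, B \in H -> #|B| = s, ~~ has_matching l H
    & max_no_matching k s l = #|H|].
Proof.
move=> l0.
have P0 : uniform s (set0 : {set {set 'I_k}}) && ~~ has_matching l (set0 : {set {set 'I_k}}).
  apply/andP; split; first by apply/forallP => A; rewrite inE.
  apply/existsPn => E; rewrite negb_and; apply/orP; left.
  by apply/forallPn; exists (Ordinal l0); rewrite inE.
have [|H /andP[uH nH] eH] := @eq_bigmax_cond _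
  (fun H : {set {set 'I_k}} => uniform s H && ~~ has_matching l H) (fun H => #|H|).
  by apply/card_gt0P; exists set0.
exists H; split => // B BH; exact/eqP/(implyP (forallP uH B)).
Qed.

Lemma max_no_matching_lt k s l : l * s <= k -> 0 < l ->
  max_no_matching k s l < 'C(k, s).
Proof.
move=> lsk l0; have [H [Hs nH ->]] := max_no_matching_attained k s l0.
have sub : H \subset [set B : {set 'I_k} | #|B| == s].
  by apply/subsetP => B /Hs; rewrite inE => ->.
rewrite -[k in 'C(k, _)]card_ord -card_draws ltn_neqAle subset_leq_card // andbT.
apply: contra nH => /eqP cH; have eH : H = [set B : {set 'I_k} | #|B| == s].
  by apply/eqP; rewrite eqEcard sub cH leqnn.
have [|||N [_ cN dN]] := @extend_disjoint _ 'I_l (fun _ => set0 : {set 'I_k}) (fun _ => s).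
- by move=> i j _; rewrite -setI_eq0 set0I.
- by move=> i; rewrite cards0.
- by rewrite sum_nat_const !card_ord.
apply/existsP; exists [ffun i => N i]; apply/andP; split.
  by apply/forallP => i; rewrite ffunE eH inE cN.
by apply/forallP => i; apply/forallP => j; apply/implyP => ij; rewrite !ffunE dN.
Qed.

(* An edge [A], enumerated by [f], is seen through the sets [[set i | f i \notin A']]
   that the other edges [A'] leave uncovered. *)
Lemma focal_free_criterion n r k s l (H : {set {set 'I_k}}) (F : {set {set 'I_n}}) :
    3 <= r -> l <= r - 1 -> k = l * s + (r - 1 - l) * s.+1 ->
    ~~ has_matching l H -> uniform k F ->
    (forall A, A \in F -> exists f : {ffun 'I_k -> 'I_n}, [/\ injective f,
       f @: [set: 'I_k] = A & forall A', A' \in F -> A' != A ->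
         s <= #|[set i | f i \notin A']| /\
         (#|[set i | f i \notin A']| = s -> [set i | f i \notin A'] \in H)]) ->
  focal_free r F.
Proof.
move=> r3 lr kE nH /forallP uF crit; apply/existsPn => A0; apply/existsPn => A.
apply/negP => /and3P[A0F /forallP AF].
have cF B : B \in F -> #|B| = k by move=> BF; apply/eqP/(implyP (uF B)).
have cA i : #|A i| = #|A0| by rewrite !cF ?AF.
case/(focalP r3 cA) => nA0 dA.
have [f [fi fA0 ownf]] := crit A0 A0F.
pose N i := [set y | f y \notin A i].
have dN i j : i != j -> [disjoint N i & N j].
  move=> ij; apply/pred0Pn => -[y /=]; rewrite !inE => /andP[yi yj].
  have fy : f y \in A0 by rewrite -fA0 imset_f.
  by have := disjointFr (dA i j ij) (_ : f y \in _); rewrite !inE fy yi yj => /(_ isT).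
have Nown i := ownf (A i) (AF i) (nA0 i).
have sN := sum_card_disjoint dN; rewrite card_ord in sN.
pose J := [set i | #|N i| == s].
have lJ : l <= #|J|.
  rewrite leqNgt; apply/negP => Jl.
  have : \sum_i (s + (i \notin J)) <= k.
    apply: leq_trans sN; apply: leq_sum => i _; have [sNi _] := Nown i.
    rewrite inE; case: eqVneq => [->|ne] /=; first by rewrite addn0.
    by rewrite addn1 ltn_neqAle eq_sym ne.
  rewrite big_split /= sum_nat_const card_ord.
  have -> : \sum_(i < r - 1) (i \notin J) = #|~: J|.
    rewrite -[RHS]sum1_card [RHS]big_mkcond; apply: eq_bigr => i _.
    by rewrite [i \in ~: _]inE; case: (i \in J).
  have kr : k = (r - 1) * s + (r - 1 - l).
    by rewrite [LHS]kE mulnS addnCA -mulnDl subnKC // addnC.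
  rewrite {1}kr leq_add2l; have := cardsC J; rewrite card_ord => cJ.
  by move: (#|J|) (#|~: J|) Jl cJ => x y; lia.
move: nH => /existsPn /(_ [ffun j => N (enum_val (widen_ord lJ j))]).
apply/negP; rewrite negbK; apply/andP; split.
  apply/forallP => j; rewrite ffunE; have [_ ] := Nown (enum_val (widen_ord lJ j)).
  apply; have := enum_valP (widen_ord lJ j).
  by rewrite inE => /eqP.
apply/forallP => i; apply/forallP => j; apply/implyP => ij; rewrite !ffunE dN //.
apply: contra ij => /eqP /enum_val_inj /(congr1 val) /= ij.
by apply/eqP/val_inj.
Qed.

Definition own_sets n (F : {set {set 'I_n}}) (j : nat) (A : {set 'I_n}) :=
  [set U : {set 'I_n} | [&& #|U| == j, U \subset A
     & [forall A' in F, (U \subset A') ==> (A' == A)]]].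

Lemma sum_own_sets n (F : {set {set 'I_n}}) j : \sum_(A in F) #|own_sets F j A| <= 'C(n, j).
Proof.
rewrite -[n in 'C(n, _)]card_ord -card_draws -[leqRHS]sum1_card.
under eq_bigr do rewrite -sum1_card.
rewrite (exchange_big_dep (mem [set U : {set 'I_n} | #|U| == j])) /=; last first.
  by move=> A U _; rewrite !inE => /and3P[].
apply: leq_sum => U _; rewrite sum1dep_card; apply/card_le1_eqP => A A'.
rewrite !inE => /andP[AF /and3P[_ UA ownA]] /andP[A'F /and3P[_ UA' _]].
by have := implyP (implyP (forallP ownA A') A'F) UA' => /eqP.
Qed.

Lemma focal_free_card_le n r k s l (F : {set {set 'I_n}}) :
    3 <= r -> 0 < l <= r - 1 -> k = l * s + (r - 1 - l) * s.+1 ->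
    uniform k F -> focal_free r F ->
  #|F| * ('C(k, s) - max_no_matching k s l)
  <= 'C(n, k - s) + 'C(n, k - s.+1) * ('C(k, s) - max_no_matching k s l).
Proof.
move=> r3 /andP[l0 lr] kE /forallP uF ff.
have cF B : B \in F -> #|B| = k by move=> BF; apply/eqP/(implyP (uF B)).
set b := 'C(k, s) - _.
pose F1 := [set A in F | own_sets F (k - s.+1) A != set0].
have F1F : F1 \subset F by apply/subsetP => A; rewrite inE => /andP[].
have cF1 : #|F1| <= 'C(n, k - s.+1).
  apply: leq_trans (sum_own_sets F _); rewrite -sum1_card [leqRHS](big_setID F1) /=.
  rewrite (setIidPr F1F).
  apply: leq_trans (leq_addr _ _); apply: leq_sum => A.
  by rewrite inE card_gt0 => /andP[].
have key A : A \in F -> A \notin F1 -> b <= #|own_sets F (k - s) A|.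
  move=> AF; rewrite inE AF /= negbK => /eqP own0.
  have [f fi fA] := exists_enumeration (cF A AF).
  have fsub (B : {set 'I_k}) : f @: B \subset A by rewrite -fA imsetS // subsetT.
  pose own B := [forall A' in F, (f @: (~: B) \subset A') ==> (A' == A)].
  pose H := [set B : {set 'I_k} | (#|B| == s) && ~~ own B].
  have cH : #|H| <= max_no_matching k s l.
    suff nH : ~~ has_matching l H.
      apply: (@leq_bigmax_cond _ (fun H : {set {set 'I_k}} => uniform s H && ~~ has_matching l H)
        (fun H => #|H|)).
      by rewrite nH andbT; apply/forallP => B; rewrite inE; apply/implyP => /andP[].
    apply/negP => /existsP[E /andP[/forallP EH /forallP dE]].
    pose M (i : 'I_(r - 1)) : {set 'I_k} := if insub (i : nat) is Some j then E j else set0.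
    have Mlt (i : 'I_(r - 1)) (il : i < l) : M i = E (Ordinal il) by rewrite /M insubT.
    have Mge (i : 'I_(r - 1)) : l <= i -> M i = set0.
      by move=> li; rewrite /M insubF // ltnNge li.
    have [|||N [MN cN dN]] := @extend_disjoint _ _ M (fun i => if i < l then s else s.+1).
    - move=> i j ij; case: (ltnP i l) => [il|/Mge ->]; last by rewrite -setI_eq0 set0I.
      case: (ltnP j l) => [jl|/Mge ->]; last by rewrite -setI_eq0 setI0.
      rewrite !Mlt; apply: (implyP (forallP (dE _) _)).
      by apply: contra ij => /eqP[ij]; apply/eqP/val_inj.
    - move=> i; case: ltnP => [il|/Mge ->]; last by rewrite cards0.
      by rewrite Mlt; have := EH (Ordinal il); rewrite inE => /andP[/eqP ->].
    - by rewrite card_ord [leqRHS]kE -sum_two_sizes.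
    have /fin_all_exists[A' A'P] (i : 'I_(r - 1)) :
        exists A' : {set 'I_n}, [/\ A' \in F, A' != A & f @: (~: N i) \subset A'].
      have notown : ~~ own (N i).
        case: (ltnP i l) => il.
          have -> : N i = E (Ordinal il).
            apply/eqP; rewrite eq_sym eqEcard -Mlt MN cN il /=.
            by rewrite Mlt; have := EH (Ordinal il); rewrite inE => /andP[/eqP ->].
          by have := EH (Ordinal il); rewrite inE => /andP[].
        apply/negP => ownN; move/setP/(_ (f @: (~: N i))): own0; rewrite !inE => /negP; apply.
        rewrite card_imset // fsub; apply/andP; split; last exact: ownN.
        have := cardsC (N i); rewrite card_ord cN ltnNge il /= => cNi.
        by apply/eqP; apply: (canRL (addKn _) cNi).
      case/forallPn: notown => A'; rewrite !negb_imply => /and3P[A'F sub ne].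
      by exists A'.
    move: ff => /existsPn/(_ A)/existsPn/(_ [ffun i => A' i]); apply/negP; rewrite negbK.
    rewrite AF /=; apply/andP; split.
      by apply/forallP => i; rewrite ffunE; case: (A'P i).
    apply/focalP => // [i|]; first by rewrite ffunE !cF //; case: (A'P i).
    split=> [i|i j ij]; first by rewrite ffunE; case: (A'P i).
    apply/pred0Pn => -[x /=]; rewrite !inE !ffunE => /andP[/andP[xi xA] /andP[xj _]].
    have /imsetP[y _ xy] : x \in f @: [set: 'I_k] by rewrite fA.
    have yN u : x \notin A' u -> y \in N u.
      apply: contraNT => yu; have [_ _ /subsetP] := A'P u; apply.
      by rewrite xy imset_f // inE.
    by have := disjointFr (dN i j ij) (yN i xi); rewrite yN.
  have -> : b = 'C(k, s) - max_no_matching k s l by [].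
  apply: leq_trans (leq_sub2l _ cH) _.
  rewrite -[k in 'C(k, _)]card_ord -card_draws -cardsDS; last first.
    by apply/subsetP => B; rewrite !inE => /andP[].
  have fC_inj : injective (fun B => f @: (~: B)).
    by move=> B B' /(imset_inj fi) /setC_inj.
  rewrite -(card_imset _ fC_inj); apply/subset_leq_card/subsetP => _ /imsetP[B + ->].
  rewrite !inE => /andP[+ /eqP Bs]; rewrite Bs eqxx /= negbK => ownB.
  rewrite card_imset // fsub; apply/andP; split; last exact: ownB.
  by have := cardsC B; rewrite card_ord Bs => cB; apply/eqP; apply: (canRL (addKn _) cB).
rewrite -(cardsID F1 F) mulnDl addnC leq_add //; last first.
  by rewrite leq_mul2r (leq_trans _ cF1) ?orbT // subset_leq_card // subsetIr.
apply: leq_trans (sum_own_sets F _); rewrite (big_setID F1) /=.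
apply: leq_trans (leq_addl _ _); rewrite -sum_nat_const leq_sum // => A.
by rewrite inE => /andP[AF1 AF]; apply: key.
Qed.

End FocalFree.

(** * Asymptotics *)

Lemma ceil_divE r k : (3 <= r)%N ->
  ceil_div ((r - 2) * k) (r - 1) = (k - k %/ (r - 1))%N.
Proof.
move=> r3; rewrite /ceil_div (_ : Num.ceil _ = (k - k %/ (r - 1))%N%:Z) ?absz_nat //.
have c0 : (0 : rat) < (r - 1)%:R by rewrite ltr0n; lia.
have := divn_eq k (r - 1); have : (k %% (r - 1) < r - 1)%N by rewrite ltn_mod; lia.
move: (k %/ _)%N (k %% _)%N => s m mr kE.
apply: ceil_def; rewrite ltr_pdivlMr // ler_pdivrMr // rmorphB /= mulrBl mul1r.
rewrite ltrBlDr -!pmulrn -!natrM -natrD ltr_nat ler_nat.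
have [c rE] : exists c, r = c.+2 by exists (r - 2)%N; lia.
rewrite {}rE in r3 mr kE *; move: mr kE; rewrite !subSS !subn0 => mr ->.
by rewrite mulnBl; apply/andP; split; nia.
Qed.

Lemma focal_free_lower (R : archiRealFieldType) (r k s l : nat) (e : R) :
    (3 <= r)%N -> (0 < l <= r - 1)%N -> k = (l * s + (r - 1 - l) * s.+1)%N -> (0 < k)%N ->
    0 < e < 1 ->
  exists n0, forall n, (n0 <= n)%N ->
    (1 - e) * 'C(n, k - s)%:R
    <= ('C(k, s) - max_no_matching k s l)%:R * (max_focal_free r n k)%:R.
Proof.
move=> r3 /andP[l0 lr] kE k0 e01.
have [H [Hs nH mH]] := max_no_matching_attained k s l0.
have lsk : (l * s <= k)%N by rewrite [leqRHS]kE leq_addr.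
have sk : (s <= k)%N by rewrite (leq_trans _ lsk) // leq_pmull.
have b0 := max_no_matching_lt lsk l0.
have [s0|s_gt0] := posnP s.
  exists 0%N => n _; rewrite {1}s0 subn0.
  have -> : ('C(k, s) - max_no_matching k s l = 1)%N.
    by move: b0; rewrite s0 bin0; case: max_no_matching.
  rewrite mul1r; case/andP: e01 => e0 e1.
  apply: (@le_trans _ _ 'C(n, k)%:R).
    by rewrite ler_piMl //; lra.
  rewrite ler_nat -[n in 'C(n, _)]card_ord -card_draws.
  apply: (@leq_bigmax_cond _ (fun F : {set {set 'I_n}} => uniform k F && focal_free r F)
        (fun F => #|F|)).
  have uF : uniform k [set A : {set 'I_n} | #|A| == k].
    by apply/forallP => A; rewrite inE; apply/implyP.
  rewrite uF; apply: (focal_free_criterion r3 lr kE nH uF) => A; rewrite inE => /eqP cA.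
  have [f fi fA] := exists_enumeration cA; exists f; split => // A'.
  rewrite inE => /eqP cA' AA'; rewrite s0; split => // /eqP; rewrite cards_eq0 => /eqP f0.
  case/negP: AA'; rewrite eq_sym eqEcard cA cA' leqnn andbT -fA.
  apply/subsetP => _ /imsetP[i _ ->]; apply/negPn/negP => fiA'.
  by move/setP/(_ i): f0; rewrite !inE fiA'.
pose T := [set ~: B | B : {set 'I_k} in [set B : {set 'I_k} | #|B| == s] :\: H].
have cT : #|T| = ('C(k, s) - max_no_matching k s l)%N.
  rewrite card_imset; last exact: setC_inj.
  rewrite cardsDS; last by apply/subsetP => B /Hs; rewrite inE => ->.
  by rewrite card_draws card_ord mH.
have T_t A : A \in T -> #|A| = (k - s)%N.
  case/imsetP => B; rewrite !inE => /andP[_ /eqP cB] ->.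
  by have := cardsC B; rewrite card_ord cB => cC; apply: (canRL (addKn _) cC).
have T_gt0 : (0 < #|T|)%N by rewrite cT subn_gt0.
have tk : (k - s < k)%N by lia.
have [n0 pack] := induced_packing T_t T_gt0 tk e01.
exists n0 => n /pack[M [Minj Mcap Mown Mcard]].
apply: le_trans Mcard _; rewrite -cT ler_wpM2l // ler_nat.
have im_inj : {in M &, injective (@image_set n k)}.
  move=> f g fM gM fg; apply/eqP/negPn/negP => ne.
  have [A AT] := card_gt0P T_gt0.
  by have := Mown f g fM gM ne A AT; rewrite -fg imsetS ?subsetT.
rewrite -(card_in_imset im_inj).
apply: (@leq_bigmax_cond _ (fun F : {set {set 'I_n}} => uniform k F && focal_free r F)
        (fun F => #|F|)).
have uF : uniform k [set image_set f | f in M].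
  apply/forallP => A; apply/implyP => /imsetP[f fM ->].
  by rewrite card_imset ?cardsT ?card_ord //; apply: Minj.
rewrite uF; apply: (focal_free_criterion r3 lr kE nH uF) => _ /imsetP[f fM ->].
exists f; split => //; first exact: Minj.
move=> _ /imsetP[g gM ->] fg; have {}fg : f != g by apply: contra fg => /eqP ->.
pose N := [set i | f i \notin image_set g].
have subg : f @: (~: N) \subset image_set g.
  by apply/subsetP => _ /imsetP[i iN ->]; move: iN; rewrite !inE negbK.
have cN : (#|~: N| <= k - s)%N.
  apply: leq_trans (Mcap f g fM gM fg); rewrite -(card_imset _ (Minj f fM)).
  by rewrite subset_leq_card // subsetI subg imsetS ?subsetT.
have cNC := cardsC N; rewrite card_ord in cNC.
split; first by rewrite -/N; lia.
rewrite -/N => Ns; apply/negPn/negP => NH.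
have NT : ~: N \in T by apply/imsetP; exists N; rewrite // !inE NH Ns eqxx.
by have := Mown f g fM gM fg _ NT; rewrite subg.
Qed.

Lemma focal_free_upper (R : archiRealFieldType) (r k s l : nat) (e : R) :
    (3 <= r)%N -> (0 < l <= r - 1)%N -> k = (l * s + (r - 1 - l) * s.+1)%N ->
    (s < k)%N -> 0 < e ->
  exists n0, forall n, (n0 <= n)%N ->
    ('C(k, s) - max_no_matching k s l)%:R * (max_focal_free r n k)%:R
    <= (1 + e) * 'C(n, k - s)%:R :> R.
Proof.
move=> r3 lr kE sk e0; set b := ('C(k, s) - _)%N.
pose n0 := Num.bound ((k * b)%:R / e); exists (k + n0)%N => n nn.
have kn : (k <= n)%N by apply: leq_trans nn; apply: leq_addr.
have n0n : (n0 <= n - (k - s.+1))%N by lia.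
have [|F /andP[uF ff] maxF] := @eq_bigmax_cond _
    (fun F : {set {set 'I_n}} => uniform k F && focal_free r F) (fun F => #|F|).
  apply/card_gt0P; exists set0; apply/andP; split.
    by apply/forallP => A; rewrite inE.
  by apply/existsPn => A; apply/existsPn => ?; rewrite inE.
rewrite /max_focal_free maxF.
have := focal_free_card_le r3 lr kE uF ff; rewrite -/b -(ler_nat R).
rewrite mulnC natrM => /le_trans; apply.
rewrite natrD mulrDl mul1r lerD2l natrM.
have := mul_bin_left n (k - s.+1); rewrite (_ : (k - s.+1).+1 = k - s)%N; last by lia.
move/(congr1 (fun x => x%:R : R)); rewrite !natrM => binE.
have n0P : (k * b)%:R / e < (n - (k - s.+1))%:R.
  apply: lt_le_trans (archi_boundP _) _; last by rewrite ler_nat.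
  by rewrite divr_ge0 // ltW.
have m0 : 0 < (n - (k - s.+1))%:R :> R by apply: le_lt_trans n0P; rewrite divr_ge0 // ltW.
have kb : (k - s)%:R * b%:R <= (n - (k - s.+1))%:R * e :> R.
  move: n0P; rewrite ltr_pdivrMr // => /ltW; apply: le_trans.
  by rewrite -natrM ler_nat leq_mul2r leq_subr orbT.
rewrite -(ler_pM2l m0) mulrA -binE mulrAC [leRHS]mulrA.
by rewrite ler_wpM2r.
Qed.

Lemma focal_free_ratio (R : archiRealFieldType) (r k s l : nat) (e : R) :
    (3 <= r)%N -> (0 < l <= r - 1)%N -> k = (l * s + (r - 1 - l) * s.+1)%N ->
    (s < k)%N -> 0 < e ->
  exists n0, forall n, (n0 <= n)%N ->
    `|1 / ('C(k, s)%:R - (max_no_matching k s l)%:R)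
      - (max_focal_free r n k)%:R / 'C(n, k - s)%:R| <= e.
Proof.
move=> r3 lr kE sk e0; case/andP: (lr) => l0 _.
have lsk : (l * s <= k)%N by rewrite [leqRHS]kE leq_addr.
have b0 := max_no_matching_lt lsk l0; rewrite -natrB ?(ltnW b0) //.
set b := (_ - _)%N; have b1 : 1 <= b%:R :> R by rewrite ler1n subn_gt0.
pose d := Num.min (2%:R^-1) e.
have d0 : 0 < d by rewrite lt_min e0 invr_gt0 ltr0n.
have de : d <= e by rewrite ge_min lexx orbT.
have d01 : 0 < d < 1.
  by rewrite d0 gt_min invf_lt1 ?ltr1n.
have k0 : (0 < k)%N by apply: leq_ltn_trans sk.
have [n1 low] := focal_free_lower r3 lr kE k0 d01.
have [n2 upp] := focal_free_upper r3 lr kE sk d0.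
exists (k + (n1 + n2))%N => n nn.
have /low{low} : (n1 <= n)%N by lia.
have /upp{upp} : (n2 <= n)%N by lia.
rewrite -/b; have c0 : 0 < 'C(n, k - s)%:R :> R by rewrite ltr0n bin_gt0; lia.
set f := (max_focal_free r n k)%:R; set c := 'C(n, k - s)%:R in c0 *.
have -> : 1 / b%:R - f / c = (c - b%:R * f) / (c * b%:R).
  by field; rewrite !gt_eqF //; lra.
move=> u w; rewrite normrM [X in _ * X]ger0_norm; last first.
  by rewrite invr_ge0 mulr_ge0 // ltW.
rewrite ler_pdivrMr; last by rewrite mulr_gt0 //; lra.
have dc : d * c <= e * (c * b%:R).
  by rewrite ler_pM ?(ltW d0) ?(ltW c0) // ler_peMr // ltW.
apply: le_trans dc; rewrite ler_norml; apply/andP; split; lra.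
Qed.

Lemma residue_decomposition r k l : (3 <= r)%N -> (1 <= l <= r - 1)%N ->
    k + l = 0 %[mod r - 1] ->
  k = (l * (k %/ (r - 1)) + (r - 1 - l) * (k %/ (r - 1)).+1)%N.
Proof.
move=> r3 /andP[l1 lr]; rewrite mod0n => kl.
have := divn_eq k (r - 1); have : (k %% (r - 1) < r - 1)%N by rewrite ltn_mod; lia.
move: kl; rewrite -modnDml; move: (k %/ _)%N (k %% _)%N => s m kl mr ->.
have -> : (m = r - 1 - l)%N.
  have [ml|ml] := ltnP (m + l) (r - 1); first by move: kl; rewrite modn_small; lia.
  move: kl; rewrite -(subnK ml) modnDr modn_small; lia.
by rewrite mulnS addnCA -mulnDl subnKC // mulnC addnC.
Qed.

Unset Implicit Arguments.
From mathcomp Require Import all_classical all_reals all_analysis.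
Import numFieldNormedType.Exports.
Local Open Scope classical_set_scope.

Theorem theorem1p2 (R : realType) (r k l : nat)
    (hr : (3 <= r)%N) (hk : (2 <= k)%N)
    (hl : (1 <= l <= r - 1)%N) (hkl : (k + l = 0 %[mod r - 1])%N) :
  (fun n : nat =>
     (max_focal_free r n k)%:R / ('C(n, ceil_div ((r - 2) * k) (r - 1)))%:R : R)
    @ \oo -->
  1 / (('C(k, ceil_div ((r - 2) * k) (r - 1)))%:R
       - (max_no_matching k (k %/ (r - 1)) l)%:R : R).
Proof.
have hl' : (0 < l <= r - 1)%N := hl.
have kE := residue_decomposition hr hl hkl.
have sk : (k %/ (r - 1) < k)%N by rewrite ltn_Pdiv //; lia.
rewrite (ceil_divE k hr) bin_sub ?(ltnW sk) //.
apply/cvgrPdist_le => e e0.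
have [n0 near_ratio] := focal_free_ratio hr hl' kE sk e0.
by exists n0 => // n /= /near_ratio.
Qed.
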